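(* Let $K$ be a field, let $E$ be a row-finite directed graph, let $H$ be a finite hereditary subset of $E^0$, and let $\overline H$ be the hereditary saturated closure of $H$. Then there is a recollement of abelian categories $$L_K(E/\overline H)\text{-Mod} \;\longrightarrow\; L_K(E)\text{-Mod} \;\longrightarrow\; L_K(E_H)\text{-Mod},$$ that is, a recollement $(\mathscr A,\mathscr B,\mathscr C)$ with $\mathscr A = L_K(E/\overline H)\text{-Mod}$, $\mathscr B = L_K(E)\text{-Mod}$ and $\mathscr C = L_K(E_H)\text{-Mod}$.
   Context: Graphs. A directed graph $E=(E^0,E^1,r,s)$ consists of a set of vertices $E^0$, a set of edges $E^1$, and maps $r,s:E^1\to E^0$ (range and source). $E$ is row-finite if $s^{-1}(v)$ is finite for every $v\in E^0$. A vertex $v$ is a sink if $s^{-1}(v)=\emptyset$. Leavitt path algebra. For a field $K$ and a row-finite graph $E$, $L_K(E)$ (also written $L(E)$) is the associative $K$-algebra generated by $\{v : v\in E^0\}\cup\{e,e^* : e\in E^1\}$ subject to: $vw=\delta_{v,w}v$ for $v,w\in E^0$; $s(e)e=e=e\,r(e)$ and $r(e)e^*=e^*=e^*s(e)$ for $e\in E^1$; $e^*f=\delta_{e,f}r(e)$ for $e,f\in E^1$; and $v=\sum_{e\in s^{-1}(v)}ee^*$ for every vertex $v$ that is not a sink. It is a ring with local units (unital if $E^0$ is finite; the zero ring if $E^0=\emptyset$). Hereditary and saturated sets. A subset $H\subseteq E^0$ is hereditary if $s(e)\in H$ implies $r(e)\in H$ for all $e\in E^1$. A subset $X\subseteq E^0$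 is saturated if every vertex $v$ with $s^{-1}(v)\neq\emptyset$ and $r(s^{-1}(v))\subseteq X$ belongs to $X$. The hereditary saturated closure $\overline H$ of a hereditary set $H$ is the smallest hereditary and saturated subset containing $H$; explicitly $\overline H=\bigcup_{n\ge 0}\Lambda_n(H)$ with $\Lambda_0(H)=H$ and $\Lambda_n(H)=\{y\in E^0 : s^{-1}(y)\ne\emptyset,\ r(s^{-1}(y))\subseteq\Lambda_{n-1}(H)\}\cup\Lambda_{n-1}(H)$ for $n\ge1$. Restriction and quotient graphs. For $H$ hereditary, $E_H$ is the graph with vertex set $H$ and edge set $\{e\in E^1 : s(e)\in H\}$, with $r,s$ restricted. For $X$ hereditary and saturated, $E/X$ is the graph with vertex set $E^0\setminus X$ and edge set $\{e\in E^1 : r(e)\notin X\}$, with $r,s$ restricted. Modules. For a ring $A$ with local units, $A\text{-Mod}$ denotes the abelian category of left $A$-modules $M$ that are unital in the sense $AM=M$ (the usual unital modules if $A$ has an identity). Recollement. A recollement of abelian categories $(\mathscr A,\mathscr B,\mathscr C)$ consists of abelian categories $\mathscr A,\mathscr B,\mathscr C$ and six functors $i:\mathscr A\to\mathscr B$, $p,q:\mathscr B\to\mathscr A$, $j:\mathscr B\to\mathscr C$, $r,s:\mathscr C\to\mathscr B$ such that: (i) $(s,j,r)$ and $(q,i,p)$ are adjoint triples, i.e. $s$ is left adjoint to $j$, $j$ is left adjoint to $r$, $q$ is left adjoint to $i$, and $i$ is left adjoint to $p$; (ii) $i$, $s$ and $r$ are fully faithful; (iii) $\operatorname{Im}(i)=\operatorname{Ker}(j)$,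 where $\operatorname{Im}(i)$ is the essential image of $i$ and $\operatorname{Ker}(j)$ is the full subcategory of objects $X$ with $j(X)\cong0$. *)

(* Defs.v *)
From HB Require Import structures.
From mathcomp Require Import all_boot all_order all_algebra.
From mathcomp Require Import finmap.
From mathcomp Require Import boolp classical_sets functions cardinality.

Set Implicit Arguments.
Unset Strict Implicit.
Unset Printing Implicit Defensive.

Import GRing.Theory.
Local Open Scope classical_set_scope.
Local Open Scope ring_scope.
Local Open Scope quotient_scope.

Record category := Category {
  obj :> Type;
  hom : obj -> obj -> Type;
  idm : forall X, hom X X;
  comp : forall X Y Z, hom Y Z -> hom X Y -> hom X Z;
  comp1m : forall X Y (f : hom X Y), comp (idm Y) f = f;
  compm1 : forall X Y (f : hom X Y), comp f (idm X) = f;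
  compA : forall X Y Z W (h : hom Z W) (g : hom Y Z) (f : hom X Y),
    comp h (comp g f) = comp (comp h g) f }.

Arguments hom {c} X Y.
Arguments idm {c} X.
Arguments comp {c X Y Z} g f.

Declare Scope cat_scope.
Delimit Scope cat_scope with cat.
Local Open Scope cat_scope.
Notation "g '\oc' f" := (comp g f)
  (at level 40, left associativity) : cat_scope.

Record functor (C D : category) := Functor {
  fobj :> C -> D;
  fmap : forall X Y, hom X Y -> hom (fobj X) (fobj Y);
  fmap1 : forall X, fmap (idm X) = idm (fobj X);
  fmapM : forall X Y Z (g : hom Y Z) (f : hom X Y),
    fmap (g \oc f) = fmap g \oc fmap f }.

Arguments fmap {C D} F {X Y} _ : rename.

Section CategoryNotions.
Variable C : category.

Definition isomorphic (X Y : C) : Prop :=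
  exists (f : hom X Y) (g : hom Y X), g \oc f = idm X /\ f \oc g = idm Y.

Definition zero_object (Z : C) : Prop :=
  forall X : C, (exists! f : hom X Z, True) /\ (exists! f : hom Z X, True).

Definition zero_morphism (X Y : C) (f : hom X Y) : Prop :=
  exists (Z : C) (h : hom Z Y) (g : hom X Z), zero_object Z /\ f = h \oc g.

Definition monic (X Y : C) (f : hom X Y) : Prop :=
  forall (W : C) (g h : hom W X), f \oc g = f \oc h -> g = h.

Definition epic (X Y : C) (f : hom X Y) : Prop :=
  forall (W : C) (g h : hom Y W), g \oc f = h \oc f -> g = h.

Definition is_product (X Y P : C) (p1 : hom P X) (p2 : hom P Y) : Prop :=
  forall (W : C) (f : hom W X) (g : hom W Y),
    exists! u : hom W P, p1 \oc u = f /\ p2 \oc u = g.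

Definition is_coproduct (X Y S : C) (i1 : hom X S) (i2 : hom Y S) : Prop :=
  forall (W : C) (f : hom X W) (g : hom Y W),
    exists! u : hom S W, u \oc i1 = f /\ u \oc i2 = g.

Definition is_kernel (N X Y : C) (f : hom X Y) (k : hom N X) : Prop :=
  zero_morphism (f \oc k) /\
  forall (W : C) (g : hom W X), zero_morphism (f \oc g) ->
    exists! u : hom W N, k \oc u = g.

Definition is_cokernel (X Y Q : C) (f : hom X Y) (c : hom Y Q) : Prop :=
  zero_morphism (c \oc f) /\
  forall (W : C) (g : hom Y W), zero_morphism (g \oc f) ->
    exists! u : hom Q W, u \oc c = g.

(* Borceux, Handbook of Categorical Algebra 2, Def. 1.4.1. No group structure
   on the hom-sets is part of the data: these axioms determine it uniquely. *)
Record abelian : Prop := Abelian {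
  abelian_zero : exists Z : C, zero_object Z;
  abelian_prod : forall X Y : C,
    exists (P : C) (p1 : hom P X) (p2 : hom P Y), is_product p1 p2;
  abelian_coprod : forall X Y : C,
    exists (S : C) (i1 : hom X S) (i2 : hom Y S), is_coproduct i1 i2;
  abelian_ker : forall (X Y : C) (f : hom X Y),
    exists (N : C) (k : hom N X), is_kernel f k;
  abelian_coker : forall (X Y : C) (f : hom X Y),
    exists (Q : C) (c : hom Y Q), is_cokernel f c;
  abelian_mono : forall (X Y : C) (f : hom X Y), monic f ->
    exists (Z : C) (g : hom Y Z), is_kernel g f;
  abelian_epi : forall (X Y : C) (f : hom X Y), epic f ->
    exists (W : C) (g : hom W X), is_cokernel g f }.

End CategoryNotions.

Definition left_adjoint (C D : category)
    (F : functor C D) (G : functor D C) : Prop :=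
  exists phi : forall (X : C) (Y : D), hom (F X) Y -> hom X (G Y),
    (forall X Y, bijective (phi X Y)) /\
    (forall (X X' : C) (Y Y' : D)
        (a : hom X' X) (b : hom Y Y') (f : hom (F X) Y),
      phi X' Y' (b \oc f \oc fmap F a) = fmap G b \oc phi X Y f \oc a).

Definition fully_faithful (C D : category) (F : functor C D) : Prop :=
  forall X Y : C, bijective (fun f : hom X Y => fmap F f).

Definition ess_image (C D : category) (F : functor C D) (Y : D) : Prop :=
  exists X : C, isomorphic (F X) Y.

Definition ker_functor (C D : category) (F : functor C D) (X : C) : Prop :=
  exists Z : D, zero_object Z /\ isomorphic (F X) Z.

Record recollement (A B C : category) := Recollement {
  rec_i : functor A B;
  rec_p : functor B A;
  rec_q : functor B A;
  rec_j : functor B C;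
  rec_r : functor C B;
  rec_s : functor C B;
  rec_abelianA : abelian A;
  rec_abelianB : abelian B;
  rec_abelianC : abelian C;
  rec_adj_sj : left_adjoint rec_s rec_j;
  rec_adj_jr : left_adjoint rec_j rec_r;
  rec_adj_qi : left_adjoint rec_q rec_i;
  rec_adj_ip : left_adjoint rec_i rec_p;
  rec_ff_i : fully_faithful rec_i;
  rec_ff_s : fully_faithful rec_s;
  rec_ff_r : fully_faithful rec_r;
  rec_im_ker : forall X : B, ess_image rec_i X <-> ker_functor rec_j X }.

HB.mixin Record Zmodule_isRng R of GRing.Zmodule R := {
  rmul : R -> R -> R;
  rmulA : associative rmul;
  rmulDl : left_distributive rmul +%R;
  rmulDr : right_distributive rmul +%R }.

#[short(type="rngType")]
HB.structure Definition Rng := { R of Zmodule_isRng R & GRing.Zmodule R }.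

HB.mixin Record Rng_isNUAlgebra (K : fieldType) R
    of Rng R & GRing.Lmodule K R := {
  rscaleAl : forall (a : K) (x y : R), a *: rmul x y = rmul (a *: x) y;
  rscaleAr : forall (a : K) (x y : R), a *: rmul x y = rmul x (a *: y) }.

#[short(type="nualgType")]
HB.structure Definition NUAlgebra (K : fieldType) :=
  { R of Rng_isNUAlgebra K R & Rng R & GRing.Lmodule K R }.

(* Left modules with A M = M; [act_unital] says that every element is a finite
   sum of products. For an algebra A with local units the scalar action on M
   is determined by the ring action, so no K-structure is recorded. *)
Record umodule (A : rngType) := UModule {
  umod_sort :> zmodType;
  act : A -> umod_sort -> umod_sort;
  actDl : forall a b m, act (a + b) m = act a m + act b m;
  actDr : forall a m n, act a (m + n) = act a m + act a n;
  actA : forall a b m, act (rmul a b) m = act a (act b m);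
  act_unital : forall m, exists s : seq (A * umod_sort),
    m = \sum_(x <- s) act x.1 x.2 }.

Record umod_hom (A : rngType) (M N : umodule A) := UModHom {
  umod_fun :> M -> N;
  umod_homD : forall m n, umod_fun (m + n) = umod_fun m + umod_fun n;
  umod_homZ : forall a m, umod_fun (act a m) = act a (umod_fun m) }.

Lemma umod_hom_eq (A : rngType) (M N : umodule A) (f g : umod_hom M N) :
  (forall m, f m = g m) -> f = g.
Proof.
case: f g => [f fD fZ] [g gD gZ] /= /funext efg; case: _ / efg gD gZ => gD gZ.
by rewrite (Prop_irrelevance fD gD) (Prop_irrelevance fZ gZ).
Qed.

Definition umod_id (A : rngType) (M : umodule A) : umod_hom M M :=
  @UModHom A M M idfun (fun _ _ => erefl) (fun _ _ => erefl).

Section ModuleComposition.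
Variables (A : rngType) (M N P : umodule A).
Variables (g : umod_hom N P) (f : umod_hom M N).

Lemma umod_compD m n : g (f (m + n)) = g (f m) + g (f n).
Proof. by rewrite !umod_homD. Qed.

Lemma umod_compZ a m : g (f (act a m)) = act a (g (f m)).
Proof. by rewrite !umod_homZ. Qed.

Definition umod_comp : umod_hom M P :=
  @UModHom A M P (fun m => g (f m)) umod_compD umod_compZ.

End ModuleComposition.

Definition Mod (A : rngType) : category.
Proof.
refine (@Category (umodule A) (@umod_hom A) (@umod_id A) (@umod_comp A) _ _ _);
  by move=> *; apply: umod_hom_eq.
Defined.

(* The algebra (without identity) generated by [X] subject to the relations [R]
   is the type of formal expressions in [X] modulo the least congruence [tcong]
   containing [R] and the laws of associative K-algebras. *)
Inductive term (K X : Type) : Type :=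
| tgen of X
| tzero
| tadd of term K X & term K X
| topp of term K X
| tscale of K & term K X
| tmul of term K X & term K X.

Arguments tgen {K X} _.
Arguments tzero {K X}.

HB.instance Definition _ (K X : Type) := gen_eqMixin (term K X).
HB.instance Definition _ (K X : Type) := gen_choiceMixin (term K X).

Section Presentation.
Variables (K : fieldType) (X : Type) (R : term K X -> term K X -> Prop).
Local Notation term := (term K X).

Inductive tcong : term -> term -> Prop :=
| tcong_rel x y : R x y -> tcong x y
| tcong_refl x : tcong x x
| tcong_sym x y : tcong x y -> tcong y x
| tcong_trans x y z : tcong x y -> tcong y z -> tcong x z
| tcong_add x x' y y' :
    tcong x x' -> tcong y y' -> tcong (tadd x y) (tadd x' y')
| tcong_opp x x' : tcong x x' -> tcong (topp x) (topp x')
| tcong_scale a x x' : tcong x x' -> tcong (tscale a x) (tscale a x')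
| tcong_mul x x' y y' :
    tcong x x' -> tcong y y' -> tcong (tmul x y) (tmul x' y')
| tcong_addA x y z : tcong (tadd x (tadd y z)) (tadd (tadd x y) z)
| tcong_addC x y : tcong (tadd x y) (tadd y x)
| tcong_add0 x : tcong (tadd tzero x) x
| tcong_addN x : tcong (tadd (topp x) x) tzero
| tcong_scaleA a b x : tcong (tscale a (tscale b x)) (tscale (a * b) x)
| tcong_scale1 x : tcong (tscale 1 x) x
| tcong_scaleDr a x y :
    tcong (tscale a (tadd x y)) (tadd (tscale a x) (tscale a y))
| tcong_scaleDl a b x :
    tcong (tscale (a + b) x) (tadd (tscale a x) (tscale b x))
| tcong_mulA x y z : tcong (tmul x (tmul y z)) (tmul (tmul x y) z)
| tcong_mulDl x y z : tcong (tmul (tadd x y) z) (tadd (tmul x z) (tmul y z))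
| tcong_mulDr x y z : tcong (tmul x (tadd y z)) (tadd (tmul x y) (tmul x z))
| tcong_scaleAl a x y : tcong (tscale a (tmul x y)) (tmul (tscale a x) y)
| tcong_scaleAr a x y : tcong (tscale a (tmul x y)) (tmul x (tscale a y)).

Definition tcongb (x y : term) : bool := `[< tcong x y >].

Lemma tcongb_refl : reflexive tcongb.
Proof. by move=> x; apply/asboolP; exact: tcong_refl. Qed.

Lemma tcongb_sym : symmetric tcongb.
Proof. by move=> x y; apply/asboolP/asboolP; exact: tcong_sym. Qed.

Lemma tcongb_trans : transitive tcongb.
Proof.
by move=> y x z /asboolP xy /asboolP yz; apply/asboolP; exact: tcong_trans yz.
Qed.

Canonical tcong_equiv := EquivRel tcongb tcongb_refl tcongb_sym tcongb_trans.

Definition presented := {eq_quot tcong_equiv}.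

HB.instance Definition _ := Choice.on presented.

Definition pclass (x : term) : presented := \pi_presented x.

Lemma pclassP (x y : term) : pclass x = pclass y <-> tcong x y.
Proof.
by split=> [/eqmodP /asboolP //|xy]; apply/eqmodP/asboolP.
Qed.

Lemma pclass_ind (P : presented -> Prop) :
  (forall x, P (pclass x)) -> forall x, P x.
Proof. by move=> Px x; rewrite -[x]reprK; exact: Px. Qed.

Lemma tcong_repr (x : term) : tcong (repr (pclass x)) x.
Proof. by apply/pclassP; rewrite /pclass reprK. Qed.

Definition padd (x y : presented) := pclass (tadd (repr x) (repr y)).
Definition popp (x : presented) := pclass (topp (repr x)).
Definition pscale (a : K) (x : presented) := pclass (tscale a (repr x)).
Definition pmul (x y : presented) := pclass (tmul (repr x) (repr y)).

Lemma paddE x y : padd (pclass x) (pclass y) = pclass (tadd x y).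
Proof. by apply/pclassP; apply: tcong_add; exact: tcong_repr. Qed.

Lemma poppE x : popp (pclass x) = pclass (topp x).
Proof. by apply/pclassP; apply: tcong_opp; exact: tcong_repr. Qed.

Lemma pscaleE a x : pscale a (pclass x) = pclass (tscale a x).
Proof. by apply/pclassP; apply: tcong_scale; exact: tcong_repr. Qed.

Lemma pmulE x y : pmul (pclass x) (pclass y) = pclass (tmul x y).
Proof. by apply/pclassP; apply: tcong_mul; exact: tcong_repr. Qed.

Lemma paddA : associative padd.
Proof.
elim/pclass_ind=> x; elim/pclass_ind=> y; elim/pclass_ind=> z.
by rewrite !paddE; apply/pclassP; exact: tcong_addA.
Qed.

Lemma paddC : commutative padd.
Proof.
elim/pclass_ind=> x; elim/pclass_ind=> y.
by rewrite !paddE; apply/pclassP; exact: tcong_addC.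
Qed.

Lemma padd0 : left_id (pclass tzero) padd.
Proof.
by elim/pclass_ind=> x; rewrite paddE; apply/pclassP; exact: tcong_add0.
Qed.

Lemma paddN : left_inverse (pclass tzero) popp padd.
Proof.
by elim/pclass_ind=> x; rewrite poppE paddE; apply/pclassP; exact: tcong_addN.
Qed.

HB.instance Definition _ :=
  GRing.isZmodule.Build presented paddA paddC padd0 paddN.

Lemma pclassD x y : pclass x + pclass y = pclass (tadd x y).
Proof. exact: paddE. Qed.

Lemma pscaleA a b x : pscale a (pscale b x) = pscale (a * b) x.
Proof.
elim/pclass_ind: x => x.
by rewrite !pscaleE; apply/pclassP; exact: tcong_scaleA.
Qed.

Lemma pscale1 : left_id 1 pscale.
Proof.
by elim/pclass_ind=> x; rewrite pscaleE; apply/pclassP; exact: tcong_scale1.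
Qed.

Lemma pscaleDr : right_distributive pscale +%R.
Proof.
move=> a; elim/pclass_ind=> x; elim/pclass_ind=> y.
by rewrite !(pscaleE, pclassD) ?pscaleE; apply/pclassP; exact: tcong_scaleDr.
Qed.

Lemma pscaleDl x : {morph pscale^~ x : a b / a + b}.
Proof.
elim/pclass_ind: x => x a b.
by rewrite !(pscaleE, pclassD) ?pscaleE; apply/pclassP; exact: tcong_scaleDl.
Qed.

HB.instance Definition _ :=
  GRing.Zmodule_isLmodule.Build K presented pscaleA pscale1 pscaleDr pscaleDl.

Lemma pmulA : associative pmul.
Proof.
elim/pclass_ind=> x; elim/pclass_ind=> y; elim/pclass_ind=> z.
by rewrite !pmulE; apply/pclassP; exact: tcong_mulA.
Qed.

Lemma pmulDl : left_distributive pmul +%R.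
Proof.
elim/pclass_ind=> x; elim/pclass_ind=> y; elim/pclass_ind=> z.
by rewrite !(pmulE, pclassD) ?pmulE; apply/pclassP; exact: tcong_mulDl.
Qed.

Lemma pmulDr : right_distributive pmul +%R.
Proof.
elim/pclass_ind=> x; elim/pclass_ind=> y; elim/pclass_ind=> z.
by rewrite !(pmulE, pclassD) ?pmulE; apply/pclassP; exact: tcong_mulDr.
Qed.

HB.instance Definition _ :=
  Zmodule_isRng.Build presented pmulA pmulDl pmulDr.

Lemma pscaleAl (a : K) (x y : presented) :
  a *: rmul x y = rmul (a *: x) y.
Proof.
elim/pclass_ind: x => x; elim/pclass_ind: y => y.
rewrite /GRing.scale /rmul /= !(pmulE, pscaleE).
by apply/pclassP; exact: tcong_scaleAl.
Qed.

Lemma pscaleAr (a : K) (x y : presented) :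
  a *: rmul x y = rmul x (a *: y).
Proof.
elim/pclass_ind: x => x; elim/pclass_ind: y => y.
rewrite /GRing.scale /rmul /= !(pmulE, pscaleE).
by apply/pclassP; exact: tcong_scaleAr.
Qed.

HB.instance Definition _ :=
  Rng_isNUAlgebra.Build K presented pscaleAl pscaleAr.

End Presentation.

(* Classically every type carries a choiceType structure, so this is no
   restriction on the sets of vertices and edges. *)
Record graph := Graph {
  vertex : choiceType;
  edge : choiceType;
  src : edge -> vertex;
  tgt : edge -> vertex }.

Arguments src {g} e.
Arguments tgt {g} e.

Section GraphNotions.
Variable E : graph.
Implicit Types (v : vertex E) (H X : set (vertex E)).

Definition out_edges v : set (edge E) := [set e | src e = v].

Definition row_finite : Prop := forall v, finite_set (out_edges v).

Definition sink v : Prop := out_edges v = set0.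

Definition hereditary H : Prop := forall e : edge E, H (src e) -> H (tgt e).

Definition saturated X : Prop :=
  forall v, out_edges v !=set0 -> tgt @` out_edges v `<=` X -> X v.

Definition hs_closure H : set (vertex E) :=
  smallest [set X | hereditary X /\ saturated X] H.

Lemma hs_closure_hereditary H : hereditary (hs_closure H).
Proof.
by move=> e Hs X HX; case: (HX) => -[hX _] _; apply: hX; exact: Hs.
Qed.

Lemma hs_closure_saturated H : saturated (hs_closure H).
Proof.
move=> v v0 rv X HX; case: (HX) => -[_ sX] _; apply: sX => //.
by move=> w /rv; exact.
Qed.

Lemma restrict_tgt_subproof H (hH : hereditary H)
  (e : set_type [set e : edge E | H (src e)]) : tgt (val e) \in H.
Proof. by apply/mem_set; apply: hH; exact: set_mem (valP e). Qed.

Definition restrict_graph H (hH : hereditary H) : graph :=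
  @Graph (set_type H) (set_type [set e : edge E | H (src e)])
    (fun e => SigSub (valP e : src (val e) \in H))
    (fun e => SigSub (restrict_tgt_subproof hH e)).

Definition quotient_vertices X : set (vertex E) := ~` X.
Definition quotient_edges X : set (edge E) := [set e | ~ X (tgt e)].

Lemma quotient_src_subproof X (hX : hereditary X)
  (e : set_type (quotient_edges X)) : src (val e) \in quotient_vertices X.
Proof.
by apply/mem_set => Xs; apply: (set_mem (valP e)); exact: hX.
Qed.

Lemma quotient_tgt_subproof X (e : set_type (quotient_edges X)) :
  tgt (val e) \in quotient_vertices X.
Proof. by apply/mem_set; exact: set_mem (valP e). Qed.

(* Saturation of [X] is not needed for the quotient graph to be well defined,
   only for its role in the theory. *)
Definition quotient_graph X (hX : hereditary X) (_ : saturated X) : graph :=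
  @Graph (set_type (quotient_vertices X)) (set_type (quotient_edges X))
    (fun e => SigSub (quotient_src_subproof hX e))
    (fun e => SigSub (quotient_tgt_subproof e)).

End GraphNotions.

Section Leavitt.
Variables (K : fieldType) (E : graph).

Inductive lpa_gen : Type :=
| gen_vertex of vertex E
| gen_edge of edge E
| gen_ghost of edge E.

Local Notation tm := (term K lpa_gen).
Definition tvertex (v : vertex E) : tm := tgen (gen_vertex v).
Definition tedge (e : edge E) : tm := tgen (gen_edge e).
Definition tghost (e : edge E) : tm := tgen (gen_ghost e).

(* In [lpa_ck2] the finiteness hypothesis makes [fset_set] meaningful and holds
   at every vertex of a row-finite graph; the order of summation is immaterial
   modulo the algebra laws. *)
Inductive lpa_rel : tm -> tm -> Prop :=
| lpa_vv v : lpa_rel (tmul (tvertex v) (tvertex v)) (tvertex v)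
| lpa_vw v w : v <> w -> lpa_rel (tmul (tvertex v) (tvertex w)) tzero
| lpa_se e : lpa_rel (tmul (tvertex (src e)) (tedge e)) (tedge e)
| lpa_er e : lpa_rel (tmul (tedge e) (tvertex (tgt e))) (tedge e)
| lpa_re e : lpa_rel (tmul (tvertex (tgt e)) (tghost e)) (tghost e)
| lpa_es e : lpa_rel (tmul (tghost e) (tvertex (src e))) (tghost e)
| lpa_ee e : lpa_rel (tmul (tghost e) (tedge e)) (tvertex (tgt e))
| lpa_ef e f : e <> f -> lpa_rel (tmul (tghost e) (tedge f)) tzero
| lpa_ck2 v : finite_set (out_edges v) -> ~ sink v ->
    lpa_rel (tvertex v)
      (\big[@tadd K lpa_gen/tzero]_(e <- fset_set (out_edges v))
         tmul (tedge e) (tghost e)).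

Definition leavitt : nualgType K := presented lpa_rel.

End Leavitt.

(* Main.v *)
(** The algebra is replaced by its action: an action of L(E) on a K-vector
    space V is the same as a family of operators on V indexed by the vertices,
    edges and ghost edges of E satisfying the defining relations.  Hence all
    the functors are obtained by writing down such families, and neither tensor
    products nor the injectivity of L(E_H) -> L(E) are needed.

    j(M) is the part of M on which L(E_H) acts unitally.  For an L(E_H)-module N
    let F(N) be the space of N-valued functions on the paths that meet H only at
    their end point, with value at a path lying in the component of N at that end
    point; L(E) acts on it by adding and removing edges at the beginning of
    paths.  Then r(N) is the unital part of F(N) and s(N) is the submodule of F(N)
    generated by the functions supported on trivial paths.  The unit of (j, r)
    sends m to the function taking a path l to l^* m, and it is injective on the
    submodule generated by j(M); the counit of (s, j) is obtained by inverting it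
    there.

    i(Y) is Y with all vertices of the closure of H, and all edges ending there,
    acting by zero.  Its essential image consists of the modules killed by the
    closure of H, so p and q are the largest submodule and the largest quotient of
    this kind.  The vertices killing a given module form a hereditary saturated
    set, whence Im i = Ker j. *)

From Pilot Require Import Defs.
From HB Require Import structures.
From mathcomp Require Import all_boot all_algebra finmap.
From mathcomp Require Import boolp classical_sets functions cardinality.
(* [all_algebra] rebinds [hom]. *)
Import Pilot.Defs.

Set Implicit Arguments.
Unset Strict Implicit.
Unset Printing Implicit Defensive.

Import GRing.Theory.
Local Open Scope classical_set_scope.
Local Open Scope ring_scope.
Local Open Scope quotient_scope.

(** * Modules without unitality, submodules and quotients *)

(** The space of functions on paths need not be unital, so modules are first considered without that
    condition and the unital part is cut out afterwards. *)
Record nmodule (A : rngType) := NModule {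
  nmod_sort :> zmodType;
  nact : A -> nmod_sort -> nmod_sort;
  nactDl : forall a b m, nact (a + b) m = nact a m + nact b m;
  nactDr : forall a m n, nact a (m + n) = nact a m + nact a n;
  nactA : forall a b m, nact (rmul a b) m = nact a (nact b m) }.

Definition nmod_of (A : rngType) (M : umodule A) : nmodule A :=
  NModule (@actDl A M) (@actDr A M) (@actA A M).
Coercion nmod_of : umodule >-> nmodule.
Canonical nmod_of.

Definition left_units (A : rngType) : Prop :=
  forall a : A, exists u : A, rmul u a = a.

Section NModuleTheory.
Variables (A : rngType) (M : nmodule A).

Lemma nact0r (a : A) : nact a (0 : M) = 0.
Proof. by apply: (addrI (nact a 0)); rewrite -nactDr !addr0. Qed.

Lemma nact0l (m : M) : nact (0 : A) m = 0.
Proof. by apply: (addrI (nact 0 m)); rewrite -nactDl !addr0. Qed.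

Lemma nactNr (a : A) (m : M) : nact a (- m) = - nact a m.
Proof. by apply: (addrI (nact a m)); rewrite -nactDr !subrr nact0r. Qed.

Lemma nactNl (a : A) (m : M) : nact (- a) m = - nact a m.
Proof. by apply: (addrI (nact a m)); rewrite -nactDl !subrr nact0l. Qed.

Lemma nact_sumr (I : Type) (r : seq I) (a : A) (F : I -> M) :
  nact a (\sum_(i <- r) F i) = \sum_(i <- r) nact a (F i).
Proof. by apply: (big_morph (nact a) (nactDr a) (nact0r a)). Qed.

Definition has_unit (m : M) : Prop := exists u : A, nact u m = m.

Hypothesis luA : left_units A.

Lemma has_unit_act (a : A) (m : M) : has_unit (nact a m).
Proof. by have [u ua] := luA a; exists u; rewrite -nactA ua. Qed.

Lemma has_unit0 : has_unit (0 : M).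
Proof. by exists 0; rewrite nact0r. Qed.

(* [u + w - w u] is a unit for both [m] and [n]
   if [u] is one for [m] and [w] is one for [n - u n]. *)
Lemma has_unitD (m n : M) : has_unit m -> has_unit n -> has_unit (m + n).
Proof.
move=> [u um] [u' un]; pose d := u' - rmul u u'; have [w wd] := luA d.
have dn : nact d n = n - nact u n by rewrite nactDl nactNl nactA un.
have wn : nact w n = n - nact u n + nact w (nact u n).
  by rewrite -dn -{1}wd nactA dn nactDr nactNr subrK.
exists (u + w - rmul w u); rewrite !nactDl nactNl nactA !nactDr um {1}wn.
by rewrite [nact w m + (_ + _)]addrCA [m + nact u n + _]addrA addrK addrACA
  subrr addr0.
Qed.

Lemma has_unitN (m : M) : has_unit m -> has_unit (- m).
Proof. by move=> [u um]; exists u; rewrite nactNr um. Qed.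

End NModuleTheory.

(** Products have units because [A] has left units, and units can be combined for sums; so [A M = M]
    amounts to every element being fixed by some element of [A]. *)
Lemma umod_has_unit (A : rngType) (luA : left_units A) (M : umodule A) (m : M) :
  has_unit m.
Proof.
have [s ->] := act_unital m; elim/big_ind: _ => [|x y|x _].
- exact: has_unit0.
- exact: has_unitD.
- exact: (@has_unit_act A M).
Qed.

Record submod (A : rngType) (M : nmodule A) := SubMod {
  smem :> M -> Prop;
  smem0 : smem 0;
  smemD : forall m n, smem m -> smem n -> smem (m + n);
  smemN : forall m, smem m -> smem (- m);
  smemA : forall a m, smem m -> smem (nact a m) }.

Definition spred (A : rngType) (M : nmodule A) (S : submod M) : {pred M} :=
  fun m => `[<S m>].

Lemma spred_closed (A : rngType) (M : nmodule A) (S : submod M) :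
  zmod_closed (spred S).
Proof.
split=> [|m n /asboolP Sm /asboolP Sn]; apply/asboolP; first exact: smem0.
by apply: smemD => //; exact: smemN.
Qed.

HB.instance Definition _ (A : rngType) (M : nmodule A) (S : submod M) :=
  GRing.isZmodClosed.Build M (spred S) (spred_closed S).

Record sub_type (A : rngType) (M : nmodule A) (S : submod M) :=
  SubElt { sub_val : M; _ : sub_val \in spred S }.

HB.instance Definition _ (A : rngType) (M : nmodule A) (S : submod M) :=
  [isSub for @sub_val A M S].
HB.instance Definition _ (A : rngType) (M : nmodule A) (S : submod M) :=
  [Choice of sub_type S by <:].
HB.instance Definition _ (A : rngType) (M : nmodule A) (S : submod M) :=
  [SubChoice_isSubZmodule of sub_type S by <:].

Section SubModule.
Variables (A : rngType) (M : nmodule A) (S : submod M).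

Definition in_sub (m : M) (Sm : S m) : sub_type S := SubElt (asboolT Sm).

Lemma sub_valP (x : sub_type S) : S (val x).
Proof. exact: asboolW (valP x). Qed.

Definition sub_act (a : A) (x : sub_type S) : sub_type S :=
  in_sub (smemA a (sub_valP x)).

Lemma sub_actDl a b x : sub_act (a + b) x = sub_act a x + sub_act b x.
Proof. by apply: val_inj; rewrite raddfD /= nactDl. Qed.

Lemma sub_actDr a x y : sub_act a (x + y) = sub_act a x + sub_act a y.
Proof. by apply: val_inj; rewrite raddfD /= nactDr. Qed.

Lemma sub_actA a b x : sub_act (rmul a b) x = sub_act a (sub_act b x).
Proof. by apply: val_inj; rewrite /= nactA. Qed.

Hypothesis hS : forall m, S m -> has_unit m.

Lemma sub_act_unital (x : sub_type S) :
  exists s : seq (A * sub_type S), x = \sum_(y <- s) sub_act y.1 y.2.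
Proof.
have [u ux] := hS (sub_valP x); exists [:: (u, x)].
by rewrite big_seq1; apply: val_inj; rewrite /= -[LHS]ux.
Qed.

Definition sub_umod : umodule A :=
  UModule sub_actDl sub_actDr sub_actA sub_act_unital.

End SubModule.

Section Quotient.
Variables (A : rngType) (M : umodule A) (S : submod M).

Definition quot_type : zmodType := Quotient.quot (spred S).

Definition to_quot (m : M) : quot_type := \pi_quot_type m.

Lemma to_quotD m n : to_quot (m + n) = to_quot m + to_quot n.
Proof. by rewrite /to_quot !piE. Qed.

Lemma to_quot0 : to_quot 0 = 0.
Proof. by apply: (addrI (to_quot 0)); rewrite -to_quotD !addr0. Qed.

Lemma to_quotK (x : quot_type) : to_quot (repr x) = x.
Proof. exact: reprK. Qed.

Lemma to_quot_eq m n : to_quot m = to_quot n <-> S (m - n).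
Proof.
split=> [/eqP | Smn]; last apply/eqP.
  by rewrite -(Quotient.idealrBE (spred S)) => /asboolP.
by rewrite -(Quotient.idealrBE (spred S)); exact/asboolP.
Qed.

Lemma repr_to_quot m : S (repr (to_quot m) - m).
Proof. by apply/to_quot_eq; rewrite to_quotK. Qed.

Definition quot_act (a : A) (x : quot_type) : quot_type :=
  to_quot (act a (repr x)).

Lemma quot_actE a m : quot_act a (to_quot m) = to_quot (act a m).
Proof.
apply/to_quot_eq; rewrite -[act a m]/(nact a m) -nactNr -nactDr.
exact: (smemA a (repr_to_quot m)).
Qed.

Lemma quot_ind (P : quot_type -> Prop) : (forall m, P (to_quot m)) -> forall x, P x.
Proof. by move=> h x; rewrite -[x]to_quotK. Qed.

Lemma quot_actDl a b x : quot_act (a + b) x = quot_act a x + quot_act b x.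
Proof. by elim/quot_ind: x => m; rewrite !quot_actE actDl to_quotD. Qed.

Lemma quot_actDr a x y : quot_act a (x + y) = quot_act a x + quot_act a y.
Proof.
elim/quot_ind: x => m; elim/quot_ind: y => n.
by rewrite -to_quotD !quot_actE actDr to_quotD.
Qed.

Lemma quot_actA a b x : quot_act (rmul a b) x = quot_act a (quot_act b x).
Proof. by elim/quot_ind: x => m; rewrite !quot_actE actA. Qed.

Lemma quot_act_unital (x : quot_type) :
  exists s : seq (A * quot_type), x = \sum_(y <- s) quot_act y.1 y.2.
Proof.
elim/quot_ind: x => m; have [s ->] := act_unital m.
exists [seq (y.1, to_quot y.2) | y <- s]; rewrite big_map.
rewrite (big_morph to_quot to_quotD to_quot0).
by apply: eq_bigr => y _; rewrite quot_actE.
Qed.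

Definition quot_umod : umodule A :=
  UModule quot_actDl quot_actDr quot_actA quot_act_unital.

Definition quot_proj : umod_hom M quot_umod :=
  @UModHom A M quot_umod to_quot to_quotD (fun a m => esym (quot_actE a m)).

Lemma quot_projP (m : M) : quot_proj m = 0 <-> S m.
Proof.
by rewrite -[m in S m]subr0 -to_quot_eq to_quot0.
Qed.

Lemma quot_proj_surj (x : quot_umod) : exists m, quot_proj m = x.
Proof. by exists (repr x); exact: to_quotK. Qed.

End Quotient.

Section HomTheory.
Variables (A : rngType) (M N : umodule A) (f : umod_hom M N).

Lemma umod_hom0 : f 0 = 0.
Proof. by apply: (addrI (f 0)); rewrite -umod_homD !addr0. Qed.

Lemma umod_homN m : f (- m) = - f m.
Proof. by apply: (addrI (f m)); rewrite -umod_homD !subrr umod_hom0. Qed.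

Lemma umod_homB m n : f (m - n) = f m - f n.
Proof. by rewrite umod_homD umod_homN. Qed.

Definition ker_submod : submod M.
Proof.
exists (fun m => f m = 0) => [|m n fm fn|m fm|a m fm]; rewrite ?umod_hom0 //.
- by rewrite umod_homD fm fn addr0.
- by rewrite umod_homN fm oppr0.
- by rewrite [LHS]umod_homZ fm (nact0r N).
Defined.

Definition im_submod : submod N.
Proof.
exists (fun n => exists m, f m = n).
- by exists 0; exact: umod_hom0.
- by move=> _ _ [m <-] [n <-]; exists (m + n); rewrite umod_homD.
- by move=> _ [m <-]; exists (- m); rewrite umod_homN.
- by move=> a _ [m <-]; exists (act a m); rewrite umod_homZ.
Defined.

End HomTheory.

(** The value at [x] is [g] at a chosen preimage of [x]. As [g] is constant on the fibres of [c],
    the choice does not matter, and this gives linearity. *)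
Lemma quot_factor (A : rngType) (M Q N : umodule A) (c : umod_hom M Q)
    (g : umod_hom M N) :
  (forall x, exists m, c m = x) -> (forall m, c m = 0 -> g m = 0) ->
  exists u : umod_hom Q N, forall m, u (c m) = g m.
Proof.
move=> csurj cg; pose l x := projT1 (cid (csurj x)).
have lE x : c (l x) = x by rewrite /l; case: cid.
have gl m x : c m = x -> g m = g (l x).
  move=> cm; apply/eqP; rewrite -subr_eq0 -umod_homB; apply/eqP/cg.
  by rewrite umod_homB lE cm subrr.
have uD x y : g (l (x + y)) = g (l x) + g (l y).
  by rewrite -umod_homD; apply/esym/gl; rewrite umod_homD !lE.
have uZ a x : g (l (act a x)) = act a (g (l x)).
  by rewrite -umod_homZ; apply/esym/gl; rewrite umod_homZ !lE.
by exists (UModHom uD uZ) => m /=; rewrite -(gl m).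
Qed.

Section SubHom.
Variables (A : rngType) (M : nmodule A) (S : submod M).
Hypothesis hS : forall m, S m -> has_unit m.

Lemma sub_corestr (W : umodule A) (g : W -> M) (gS : forall w, S (g w)) :
  (forall v w, g (v + w) = g v + g w) ->
  (forall a w, g (act a w) = nact a (g w)) ->
  exists u : umod_hom W (sub_umod hS), forall w, val (u w) = g w.
Proof.
move=> gD gZ.
have uD v w : in_sub (gS (v + w)) = in_sub (gS v) + in_sub (gS w).
  by apply: val_inj; rewrite raddfD /= gD.
have uZ a w : in_sub (gS (act a w)) = sub_act a (in_sub (gS w)).
  by apply: val_inj; rewrite /= gZ.
by exists (@UModHom A W (sub_umod hS) _ uD uZ).
Qed.

End SubHom.

(** * Categories of unital modules are abelian *)

Section Abelian.
Variables (A : rngType) (luA : left_units A).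

Definition submod_umod (M : umodule A) (S : submod M) : umodule A :=
  @sub_umod A M S (fun m _ => umod_has_unit luA m).

Definition sub_incl (M : umodule A) (S : submod M) :
    umod_hom (submod_umod S) M :=
  @UModHom A (submod_umod S) M val (raddfD val) (fun _ _ => erefl).

Lemma zero_umod_actDl (a b : A) (m : 'rV[int]_0) : m = m + m.
Proof. by rewrite [LHS]thinmx0 [RHS]thinmx0. Qed.

Lemma zero_umod_unital (m : 'rV[int]_0) :
  exists s : seq (A * 'rV[int]_0), m = \sum_(x <- s) x.2.
Proof. by exists [::]; rewrite big_nil [LHS]thinmx0. Qed.

Definition zero_umod : umodule A :=
  @UModule A 'rV[int]_0 (fun _ => id) zero_umod_actDl (fun _ _ _ => erefl)
    (fun _ _ _ => erefl) zero_umod_unital.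

Definition zero_hom (M N : umodule A) : umod_hom M N.
Proof.
by exists (fun _ => 0) => [m n|a m]; rewrite ?addr0 ?(nact0r N).
Defined.

Lemma zero_objectP (Z : Mod A) : (forall z : (Z : umodule A), z = 0) ->
  zero_object Z.
Proof.
move=> Z0 X; split.
  exists (zero_hom X Z); split=> // f _; apply: umod_hom_eq => x /=.
  by rewrite [RHS]Z0.
exists (zero_hom Z X); split=> // f _; apply: umod_hom_eq => z /=.
by rewrite [z]Z0 umod_hom0.
Qed.

Lemma zero_object_eq0 (Z : Mod A) : zero_object Z -> forall z : (Z : umodule
  A), z = 0.
Proof.
move=> /(_ Z) [_ [h [_ hu]]] z.
have := congr1 (fun f : umod_hom Z Z => f z) (hu (zero_hom Z Z) I).
by rewrite (hu (umod_id Z) I).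
Qed.

Lemma zero_morphismP (X Y : Mod A) (f : hom X Y) :
  zero_morphism f <-> forall x, (f : umod_hom X Y) x = 0.
Proof.
split=> [[Z [h [g [Z0 ->]]]] x /=|f0].
  by rewrite (zero_object_eq0 Z0 ((g : umod_hom X Z) x)) umod_hom0.
exists (zero_umod : Mod A), (zero_hom zero_umod Y), (zero_hom X zero_umod).
split; first by apply: zero_objectP => z; rewrite [LHS]thinmx0.
by apply: umod_hom_eq => x; rewrite f0.
Qed.

Section Pair.
Variables M N : umodule A.

Definition pair_act (a : A) (x : M * N) : M * N := (act a x.1, act a x.2).

Lemma pair_actDl a b x : pair_act (a + b) x = pair_act a x + pair_act b x.
Proof. by rewrite /pair_act !actDl. Qed.

Lemma pair_actDr a x y : pair_act a (x + y) = pair_act a x + pair_act a y.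
Proof. by rewrite /pair_act !actDr. Qed.

Lemma pair_actA a b x : pair_act (rmul a b) x = pair_act a (pair_act b x).
Proof. by rewrite /pair_act !actA. Qed.

Lemma pair_act_unital (x : M * N) :
  exists s : seq (A * (M * N)), x = \sum_(y <- s) pair_act y.1 y.2.
Proof.
case: x => m n; have [u um] := umod_has_unit luA m.
have [w wn] := umod_has_unit luA n.
exists [:: (u, (m, 0)); (w, (0, n))]; rewrite big_cons big_seq1 /pair_act /=.
have /= -> := nact0r N u; have /= -> := nact0r M w.
by move: um wn => /= -> ->; congr pair; rewrite ?addr0 ?add0r.
Qed.

Definition pair_umod : umodule A :=
  UModule pair_actDl pair_actDr pair_actA pair_act_unital.

Definition pair_fst : umod_hom pair_umod M :=
  @UModHom A pair_umod M fst (fun _ _ => erefl) (fun _ _ => erefl).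
Definition pair_snd : umod_hom pair_umod N :=
  @UModHom A pair_umod N snd (fun _ _ => erefl) (fun _ _ => erefl).

Definition pair_inl : umod_hom M pair_umod.
Proof.
exists (fun m => (m, 0) : pair_umod) => [m n|a m]; congr pair; rewrite ?addr0 //.
by rewrite [RHS](nact0r N).
Defined.

Definition pair_inr : umod_hom N pair_umod.
Proof.
exists (fun n => (0, n) : pair_umod) => [m n|a m]; congr pair; rewrite ?addr0 //.
by rewrite [RHS](nact0r M).
Defined.

End Pair.

(** The inclusion of the kernel and the zero map have the same composite with [f]; cancelling [f]
    shows that the kernel vanishes. *)
Lemma monic_inj (X Y : Mod A) (f : hom X Y) :
  monic f -> injective (f : umod_hom X Y).
Proof.
move=> fm x y fxy; apply/eqP; rewrite -subr_eq0; apply/eqP.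
have k : ker_submod f (x - y) by rewrite /= umod_homB fxy subrr.
have /(congr1 (fun g : umod_hom (submod_umod _) X => g (in_sub k))) // :
    sub_incl (ker_submod f) = zero_hom (submod_umod (ker_submod f)) X.
by apply: fm; apply: umod_hom_eq => z /=; rewrite umod_hom0; exact: (sub_valP z).
Qed.

(** Dually, the projection modulo the image agrees with zero after composition with [f], so this
    quotient vanishes. *)
Lemma epic_surj (X Y : Mod A) (f : hom X Y) :
  epic f -> forall y, exists x, (f : umod_hom X Y) x = y.
Proof.
move=> fe y.
have /(congr1 (fun g : umod_hom _ _ => g y)) /quot_projP // :
    quot_proj (im_submod f) = zero_hom Y (quot_umod (im_submod f)).
by apply: fe; apply: umod_hom_eq => x; apply/quot_projP; exists x.
Qed.

(** The direct sum of two modules is both product and coproduct; a monomorphism is the kernel of the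
    projection modulo its image, and an epimorphism the cokernel of the inclusion of its kernel. *)
Lemma abelian_Mod : abelian (Mod A).
Proof.
split.
- by exists (zero_umod : Mod A); apply: zero_objectP => z; rewrite [LHS]thinmx0.
- move=> X Y; exists (pair_umod X Y : Mod A), (pair_fst X Y), (pair_snd X Y).
  move=> W f g.
  pose h w : pair_umod X Y := ((f : umod_hom W X) w, (g : umod_hom W Y) w).
  have hD v w : h (v + w) = h v + h w by rewrite /h !umod_homD.
  have hZ a w : h (act a w) = act a (h w) by rewrite /h !umod_homZ.
  exists (UModHom hD hZ); split; first by split; apply: umod_hom_eq.
  move=> k [kf kg]; apply: umod_hom_eq => w.
  by rewrite /= /h -kf -kg /= -surjective_pairing.
- move=> X Y; exists (pair_umod X Y : Mod A), (pair_inl X Y), (pair_inr X Y).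
  move=> W f g.
  pose h (w : pair_umod X Y) : (W : umodule A) :=
    (f : umod_hom X W) w.1 + (g : umod_hom Y W) w.2.
  have hD v w : h (v + w) = h v + h w by rewrite /h !umod_homD addrACA.
  have hZ a w : h (act a w) = act a (h w) by rewrite /h !umod_homZ actDr.
  exists (UModHom hD hZ); split.
    by split; apply: umod_hom_eq => w; rewrite /= /h /= umod_hom0 ?addr0 ?add0r.
  move=> k [kf kg]; apply: umod_hom_eq => w.
  rewrite /= /h -kf -kg /= -umod_homD.
  by congr (umod_fun k _); case: w => x y; congr pair; rewrite ?addr0 ?add0r.
- move=> X Y f; exists (submod_umod (ker_submod f) : Mod A), (sub_incl
  (ker_submod f)).
  split; first by apply/zero_morphismP => x; exact: (sub_valP x).
  move=> W g /zero_morphismP fg.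
  have [u uE] := @sub_corestr A X (ker_submod f) (fun m _ => umod_has_unit luA m)
                   W g fg (umod_homD g) (umod_homZ g).
  exists u; split=> [|v vE]; apply: umod_hom_eq => w; first exact: uE.
  by apply: val_inj; rewrite uE -vE.
- move=> X Y f; exists (quot_umod (im_submod f) : Mod A), (quot_proj (im_submod f)).
  split; first by apply/zero_morphismP => x; apply/quot_projP; exists x.
  move=> W g /zero_morphismP gf.
  have [|y /quot_projP [x <-]|u uE] := @quot_factor A _ _ _ (quot_proj
    (im_submod f)) g.
  + exact: quot_proj_surj.
  + exact: gf.
  exists u; split=> [|v vE]; apply: umod_hom_eq => w; first exact: uE.
  by have [m <-] := quot_proj_surj w; rewrite uE -vE.
- move=> X Y f /monic_inj finj.
  exists (quot_umod (im_submod f) : Mod A), (quot_proj (im_submod f)).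
  split; first by apply/zero_morphismP => x; apply/quot_projP; exists x.
  move=> W g /zero_morphismP gf.
  have im w : im_submod f ((g : umod_hom W Y) w) by apply/quot_projP; exact: gf.
  pose h w := projT1 (cid (im w)).
  have hE w : (f : umod_hom X Y) (h w) = (g : umod_hom W Y) w by rewrite /h;
    case: cid.
  have hD v w : h (v + w) = h v + h w by apply: finj;
    rewrite umod_homD !hE umod_homD.
  have hZ a w : h (act a w) = act a (h w) by apply: finj;
    rewrite umod_homZ !hE umod_homZ.
  exists (UModHom hD hZ); split=> [|v vE]; apply: umod_hom_eq => w; first exact: hE.
  by apply: finj; rewrite /= hE -vE.
- move=> X Y f /epic_surj fsurj.
  exists (submod_umod (ker_submod f) : Mod A), (sub_incl (ker_submod f)).
  split; first by apply/zero_morphismP => x; exact: (sub_valP x).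
  move=> W g /zero_morphismP gk.
  have [//|m fm|u uE] := @quot_factor A _ _ _ f g.
    exact: (gk (in_sub (fm : ker_submod f m))).
  exists u; split=> [|v vE]; apply: umod_hom_eq => w; first exact: uE.
  by have [m <-] := fsurj w; rewrite uE -vE.
Qed.

End Abelian.

(** * Modules over presented algebras *)

Record scaling (K : fieldType) (V : zmodType) := Scaling {
  scal :> K -> V -> V;
  scalDr : forall k m n, scal k (m + n) = scal k m + scal k n;
  scalDl : forall k l m, scal (k + l) m = scal k m + scal l m;
  scalA : forall k l m, scal k (scal l m) = scal (k * l) m;
  scal1 : forall m, scal 1 m = m }.

Section UScaling.
Variables (K : fieldType) (A : nualgType K) (luA : left_units A).

(** Scalars are recovered from the ring action: [k m] is [(k u) m] for a chosen [u] fixing [m]. *)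
Definition uscal (M : umodule A) (k : K) (m : M) : M :=
  act (k *: projT1 (cid (umod_has_unit luA m))) m.

Arguments uscal : simpl never.

(** The result is independent of the unit: if [v] fixes the difference of two candidates, moving [k]
    onto [v] turns both into [(k v) m]. *)
Lemma uscalE (M : umodule A) (k : K) (u : A) (m : M) :
  act u m = m -> uscal k m = act (k *: u) m.
Proof.
rewrite /uscal; case: cid => w /= wm um.
apply/eqP; rewrite -subr_eq0; apply/eqP; set d := _ - _.
have [v <-] := umod_has_unit luA d; rewrite nactDr nactNr /=.
by rewrite -!actA -!rscaleAr !rscaleAl !actA wm um subrr.
Qed.

Lemma uscal_act (M : umodule A) (k : K) (a : A) (m : M) :
  act (k *: a) m = uscal k (act a m).
Proof.
have [u ua] := luA a; rewrite (@uscalE _ _ u) -?actA ?ua //.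
by rewrite -rscaleAl ua.
Qed.

Lemma uscal_hom (M N : umodule A) (f : umod_hom M N) k m :
  f (uscal k m) = uscal k (f m).
Proof.
have [u /= um] := umod_has_unit luA m; rewrite (uscalE k um) umod_homZ.
by rewrite -(@uscalE _ _ u) // -umod_homZ um.
Qed.

Lemma uscalDr (M : umodule A) k (m n : M) :
  uscal k (m + n) = uscal k m + uscal k n.
Proof.
have [u [/= um un]] := umod_has_unit luA ((m, n) : pair_umod luA M M).
by rewrite !(@uscalE _ _ u) // actDr ?um ?un.
Qed.

Lemma uscalDl (M : umodule A) k l (m : M) :
  uscal (k + l) m = uscal k m + uscal l m.
Proof.
have [u /= um] := umod_has_unit luA m.
by rewrite !(uscalE _ um) scalerDl actDl.
Qed.

Lemma uscalA (M : umodule A) k l (m : M) : uscal k (uscal l m) = uscal (k * l) m.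
Proof.
have [u /= um] := umod_has_unit luA m.
by rewrite (uscalE l um) -uscal_act scalerA -(uscalE _ um).
Qed.

Lemma uscal1 (M : umodule A) (m : M) : uscal 1 m = m.
Proof.
by have [u /= um] := umod_has_unit luA m; rewrite (uscalE _ um) scale1r.
Qed.

Definition uscaling (M : umodule A) : scaling K M :=
  Scaling (@uscalDr M) (@uscalDl M) (@uscalA M) (@uscal1 M).

Lemma act_uscal (M : umodule A) (k : K) (a : A) (m : M) :
  act a (uscal k m) = uscal k (act a m).
Proof.
have [u /= um] := umod_has_unit luA m.
by rewrite (uscalE _ um) -actA -rscaleAr uscal_act actA um.
Qed.

End UScaling.

Arguments uscal : simpl never.

(** Without unitality the scalars are no longer determined by the action of [A], so they become part
    of the data. *)
Record kmodule (K : fieldType) (A : nualgType K) := KModule {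
  kmod :> nmodule A;
  ksc : scaling K kmod;
  kactZl : forall k a m, nact (k *: a) m = ksc k (nact a m);
  kactZr : forall k a m, nact a (ksc k m) = ksc k (nact a m) }.

Definition kmod_of (K : fieldType) (A : nualgType K) (luA : left_units A)
    (M : umodule A) : kmodule A :=
  @KModule K A M (uscaling luA M) (uscal_act luA (M := M)) (act_uscal luA (M := M)).

Record khom (K : fieldType) (A : nualgType K) (M N : kmodule A) := KHom {
  kfun :> M -> N;
  khomD : forall m n, kfun (m + n) = kfun m + kfun n;
  khomZ : forall k m, kfun (ksc M k m) = ksc N k (kfun m);
  khomA : forall a m, kfun (nact a m) = nact a (kfun m) }.

Section PresentedTheory.
Variables (K : fieldType) (X : Type) (R : term K X -> term K X -> Prop).

Definition pgen (x : X) : presented R := pclass R (tgen x).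

Lemma presented_ind (Q : presented R -> Prop) :
  (forall x, Q (pgen x)) -> Q 0 ->
  (forall a b, Q a -> Q b -> Q (a + b)) -> (forall a, Q a -> Q (- a)) ->
  (forall k a, Q a -> Q (k *: a)) ->
  (forall a b, Q a -> Q b -> Q (rmul a b)) -> forall a, Q a.
Proof.
move=> Qg Q0 QD QN QZ QM; elim/pclass_ind; elim=> //=.
- by move=> x Qx y Qy; rewrite -[pclass R _]paddE; exact: QD.
- by move=> x Qx; rewrite -[pclass R _]poppE; exact: QN.
- by move=> k x Qx; rewrite -[pclass R _]pscaleE; exact: QZ.
- by move=> x Qx y Qy; rewrite -[pclass R _]pmulE; exact: QM.
Qed.

Section Action.
Variables (V : zmodType) (sc : scaling K V) (g : X -> V -> V).
Hypothesis gD : forall x m n, g x (m + n) = g x m + g x n.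
Hypothesis gZ : forall x k m, g x (sc k m) = sc k (g x m).

Fixpoint teval (t : term K X) (m : V) : V :=
  match t with
  | tgen x => g x m
  | tzero => 0
  | tadd s t => teval s m + teval t m
  | topp t => - teval t m
  | tscale k t => sc k (teval t m)
  | tmul s t => teval s (teval t m)
  end.

Hypothesis gR : forall s t, R s t -> forall m, teval s m = teval t m.

Lemma scal0 k : sc k 0 = 0.
Proof. by apply: (addrI (sc k 0)); rewrite -scalDr !addr0. Qed.

Lemma scalN k m : sc k (- m) = - sc k m.
Proof. by apply: (addrI (sc k m)); rewrite -scalDr !subrr scal0. Qed.

Lemma tevalD t m n : teval t (m + n) = teval t m + teval t n.
Proof.
elim: t m n => /= [x||s IHs t IHt|s IHs|k s IHs|s IHs t IHt] m n.
- exact: gD.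
- by rewrite addr0.
- by rewrite IHs IHt addrACA.
- by rewrite IHs opprD.
- by rewrite IHs scalDr.
- by rewrite IHt IHs.
Qed.

Lemma tevalZ t k m : teval t (sc k m) = sc k (teval t m).
Proof.
elim: t m => /= [x||s IHs t IHt|s IHs|l s IHs|s IHs t IHt] m.
- exact: gZ.
- by rewrite scal0.
- by rewrite IHs IHt scalDr.
- by rewrite IHs scalN.
- by rewrite IHs !scalA mulrC.
- by rewrite IHt IHs.
Qed.

(** Linear operators on [V] obey the laws of an associative algebra, so only the relations [R] are
    left as a hypothesis. Additivity and homogeneity of the operators enter at [tcong_mulDr] and
    [tcong_scaleAr]. *)
Lemma teval_cong s t : tcong R s t -> forall m, teval s m = teval t m.
Proof.
elim=> /= {s t}.
- exact: gR.
- by [].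
- by move=> x y _ IH m; rewrite IH.
- by move=> x y z _ IH1 _ IH2 m; rewrite IH1.
- by move=> x x' y y' _ IH1 _ IH2 m; rewrite IH1 IH2.
- by move=> x x' _ IH m; rewrite IH.
- by move=> k x x' _ IH m; rewrite IH.
- by move=> x x' y y' _ IH1 _ IH2 m; rewrite IH2 IH1.
- by move=> x y z m; rewrite addrA.
- by move=> x y m; rewrite addrC.
- by move=> x m; rewrite add0r.
- by move=> x m; rewrite addNr.
- by move=> k l x m; rewrite scalA.
- by move=> x m; rewrite scal1.
- by move=> k x y m; rewrite scalDr.
- by move=> k l x m; rewrite scalDl.
- by [].
- by [].
- by move=> x y z m; rewrite tevalD.
- by [].
- by move=> k x y m; rewrite tevalZ.
Qed.

Definition pact (a : presented R) (m : V) : V := teval (repr a) m.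

Lemma pactE t m : pact (pclass R t) m = teval t m.
Proof. exact: teval_cong (tcong_repr R t) m. Qed.

Lemma pactDl a b m : pact (a + b) m = pact a m + pact b m.
Proof.
elim/pclass_ind: a => s; elim/pclass_ind: b => t.
by rewrite pclassD !pactE.
Qed.

Lemma pactDr a m n : pact a (m + n) = pact a m + pact a n.
Proof. exact: tevalD. Qed.

Lemma pactA a b m : pact (rmul a b) m = pact a (pact b m).
Proof.
elim/pclass_ind: a => s; elim/pclass_ind: b => t.
by rewrite [rmul _ _]pmulE !pactE.
Qed.

Lemma pactZl k a m : pact (k *: a) m = sc k (pact a m).
Proof. by elim/pclass_ind: a => s; rewrite [k *: _]pscaleE !pactE. Qed.

Lemma pactZr k a m : pact a (sc k m) = sc k (pact a m).
Proof. exact: tevalZ. Qed.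

Definition presented_kmod : kmodule (presented R) :=
  @KModule K (presented R) (NModule pactDl pactDr pactA) sc pactZl pactZr.

End Action.
End PresentedTheory.

(** * Modules over Leavitt path algebras *)

Section LeavittTheory.
Variables (K : fieldType) (E : graph).
Local Notation L := (leavitt K E).

Definition lgen (x : lpa_gen E) : L := pgen (@lpa_rel K E) x.
Definition lv (v : vertex E) : L := lgen (gen_vertex v).
Definition le (e : edge E) : L := lgen (gen_edge e).
Definition lg (e : edge E) : L := lgen (gen_ghost e).

Lemma leavitt_ind (Q : L -> Prop) :
  (forall v, Q (lv v)) -> (forall e, Q (le e)) -> (forall e, Q (lg e)) -> Q 0 ->
  (forall a b, Q a -> Q b -> Q (a + b)) -> (forall a, Q a -> Q (- a)) ->
  (forall k a, Q a -> Q (k *: a)) ->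
  (forall a b, Q a -> Q b -> Q (rmul a b)) -> forall a, Q a.
Proof. by move=> Qv Qe Qg; apply: presented_ind; case. Qed.

Lemma leavitt_mulE s t : rmul (pclass (@lpa_rel K E) s) (pclass _ t) =
  pclass (@lpa_rel K E) (tmul s t).
Proof. exact: pmulE. Qed.

Lemma leavitt_relE s t : @lpa_rel K E s t -> pclass (@lpa_rel K E) s = pclass _ t.
Proof. by move=> st; apply/pclassP; exact: tcong_rel. Qed.

Section Relations.
Variables (M : nmodule L).
Implicit Types (m : M) (v w : vertex E) (e f : edge E).

Lemma act_vv v m : nact (lv v) (nact (lv v) m) = nact (lv v) m.
Proof. by rewrite -nactA leavitt_mulE (leavitt_relE (lpa_vv _ v)). Qed.

Lemma act_vw v w m : v <> w -> nact (lv v) (nact (lv w) m) = 0.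
Proof.
by move=> vw; rewrite -nactA leavitt_mulE (leavitt_relE (lpa_vw K vw)) nact0l.
Qed.

Lemma act_se e m : nact (lv (src e)) (nact (le e) m) = nact (le e) m.
Proof. by rewrite -nactA leavitt_mulE (leavitt_relE (lpa_se _ e)). Qed.

Lemma act_er e m : nact (le e) (nact (lv (tgt e)) m) = nact (le e) m.
Proof. by rewrite -nactA leavitt_mulE (leavitt_relE (lpa_er _ e)). Qed.

Lemma act_re e m : nact (lv (tgt e)) (nact (lg e) m) = nact (lg e) m.
Proof. by rewrite -nactA leavitt_mulE (leavitt_relE (lpa_re _ e)). Qed.

Lemma act_es e m : nact (lg e) (nact (lv (src e)) m) = nact (lg e) m.
Proof. by rewrite -nactA leavitt_mulE (leavitt_relE (lpa_es _ e)). Qed.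

Lemma act_ee e m : nact (lg e) (nact (le e) m) = nact (lv (tgt e)) m.
Proof. by rewrite -nactA leavitt_mulE (leavitt_relE (lpa_ee _ e)). Qed.

Lemma act_ef e f m : e <> f -> nact (lg e) (nact (le f) m) = 0.
Proof.
by move=> ef; rewrite -nactA leavitt_mulE (leavitt_relE (lpa_ef K ef)) nact0l.
Qed.

Lemma act_ck2 v m : finite_set (out_edges v) -> ~ sink v ->
  nact (lv v) m =
  \sum_(e <- fset_set (out_edges v)) nact (le e) (nact (lg e) m).
Proof.
move=> fv sv; rewrite [lv v](leavitt_relE (lpa_ck2 K fv sv)).
have -> : pclass (@lpa_rel K E) (\big[@tadd K (lpa_gen E)/tzero]_(e <- fset_set
      (out_edges v)) tmul (tedge K e) (tghost K e)) =
    \sum_(e <- fset_set (out_edges v)) (rmul (le e) (lg e) : L).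
  elim/big_rec2: _ => // e x y _ <-.
  by rewrite [rmul _ _]leavitt_mulE; apply/esym; exact: paddE.
rewrite (big_morph (fun a => nact a m) (id1 := 0) (op1 := +%R)).
- by apply: eq_bigr => e _; rewrite nactA.
- by move=> a b; exact: nactDl.
- exact: nact0l.
Qed.

End Relations.

Definition regular_nmod (A : rngType) : nmodule A :=
  NModule (@rmulDl A) (@rmulDr A) (fun a b m : A => esym (rmulA a b m)).

(** Finite sums of distinct vertices are left units. The stronger property [Q] asks that every
    duplicate-free list containing a given one will do, so that the lists for two summands can be
    merged; a product only needs the list of its left factor. *)
Lemma leavitt_left_units : left_units L.
Proof.
pose u (s : seq (vertex E)) : L := \sum_(v <- s) lv v.
pose Q (a : L) := exists s : seq (vertex E), forall s', uniq s' -> {subset s <=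
  s'} ->
  rmul (u s') a = a.
suff Qa : forall a, Q a.
  by move=> a; have [s sa] := Qa a; exists (u (undup s)); apply: sa => [|v];
    rewrite ?undup_uniq ?mem_undup.
have Qv v b : nact (lv v) (b : regular_nmod L) = b -> Q b.
  move=> vb; exists [:: v] => s us /(_ v (mem_head _ _)) vs.
  have -> : rmul (u s) b = \sum_(w <- s) nact (lv w) (b : regular_nmod L).
    apply: (big_morph (fun a : L => rmul a b)) => [x y|]; first exact: rmulDl.
    exact: (nact0l (b : regular_nmod L)).
  rewrite (bigD1_seq v) //= big1 ?addr0 // => w /eqP wv.
  by rewrite -vb; exact: (act_vw (M := regular_nmod L)).
elim/leavitt_ind.
- by move=> v; apply: (Qv v); rewrite /= leavitt_mulE (leavitt_relE (lpa_vv _ v)).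
- move=> e; apply: (Qv (src e)).
  by rewrite /= leavitt_mulE (leavitt_relE (lpa_se _ e)).
- move=> e; apply: (Qv (tgt e)).
  by rewrite /= leavitt_mulE (leavitt_relE (lpa_re _ e)).
- by exists [::] => s _ _; exact: (nact0r (regular_nmod L)).
- move=> a b [s sa] [t tb]; exists (s ++ t) => r ur rst.
  rewrite rmulDr sa // ?tb // => v vs; apply: rst; rewrite mem_cat vs ?orbT //.
- move=> a [s sa]; exists s => r ur rs.
  by rewrite [LHS](nactNr (M := regular_nmod L)) /= sa.
- by move=> k a [s sa]; exists s => r ur rs; rewrite -rscaleAr sa.
- by move=> a b [s sa] _; exists s => r ur rs; rewrite rmulA sa.
Qed.

Record lfamily (V : zmodType) (sc : scaling K V) := LFamily {
  fgen :> lpa_gen E -> V -> V;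
  fgenD : forall x m n, fgen x (m + n) = fgen x m + fgen x n;
  fgenZ : forall x k m, fgen x (sc k m) = sc k (fgen x m);
  fgen_vv : forall v m,
    fgen (gen_vertex v) (fgen (gen_vertex v) m) = fgen (gen_vertex v) m;
  fgen_vw : forall v w m, v <> w ->
    fgen (gen_vertex v) (fgen (gen_vertex w) m) = 0;
  fgen_se : forall e m,
    fgen (gen_vertex (src e)) (fgen (gen_edge e) m) = fgen (gen_edge e) m;
  fgen_er : forall e m,
    fgen (gen_edge e) (fgen (gen_vertex (tgt e)) m) = fgen (gen_edge e) m;
  fgen_re : forall e m,
    fgen (gen_vertex (tgt e)) (fgen (gen_ghost e) m) = fgen (gen_ghost e) m;
  fgen_es : forall e m,
    fgen (gen_ghost e) (fgen (gen_vertex (src e)) m) = fgen (gen_ghost e) m;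
  fgen_ee : forall e m,
    fgen (gen_ghost e) (fgen (gen_edge e) m) = fgen (gen_vertex (tgt e)) m;
  fgen_ef : forall e f m, e <> f ->
    fgen (gen_ghost e) (fgen (gen_edge f) m) = 0;
  fgen_ck2 : forall v m, finite_set (out_edges v) -> ~ sink v ->
    fgen (gen_vertex v) m =
    \sum_(e <- fset_set (out_edges v)) fgen (gen_edge e) (fgen (gen_ghost e) m) }.

Section Family.
Variables (V : zmodType) (sc : scaling K V) (F : lfamily sc).

Lemma lfamily_rel s t : @lpa_rel K E s t ->
  forall m, teval sc F s m = teval sc F t m.
Proof.
case=> /=.
- exact: fgen_vv.
- by move=> v w vw m; exact: fgen_vw.
- exact: fgen_se.
- exact: fgen_er.
- exact: fgen_re.
- exact: fgen_es.
- exact: fgen_ee.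
- by move=> e f ef m; exact: fgen_ef.
- move=> v fv sv m; rewrite (fgen_ck2 F) //.
  by elim/big_rec2: _ => //= e x y _ ->.
Qed.

Definition family_kmod : kmodule L :=
  presented_kmod (fgenD F) (fgenZ F) lfamily_rel.

Lemma family_actE x (m : V) : nact (lgen x) (m : family_kmod) = F x m.
Proof. exact: (pactE (fgenD F) (fgenZ F) lfamily_rel). Qed.

End Family.

Section KHomOfGenerators.
Variables (M N : kmodule L) (f : M -> N).
Hypothesis fD : forall m n, f (m + n) = f m + f n.
Hypothesis fZ : forall k m, f (ksc M k m) = ksc N k (f m).
Hypothesis fg : forall x m, f (nact (lgen x) m) = nact (lgen x) (f m).

Lemma leavitt_khomA a m : f (nact a m) = nact a (f m).
Proof.
have f0 : f 0 = 0 by apply: (addrI (f 0)); rewrite -fD !addr0.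
elim/presented_ind: a m => /=.
- exact: fg.
- by move=> m; rewrite !nact0l.
- by move=> a b IHa IHb m; rewrite !nactDl fD IHa IHb.
- move=> a IHa m; rewrite !nactNl -IHa; apply: (addrI (f (nact a m))).
  by rewrite -fD !subrr.
- by move=> k a IHa m; rewrite !kactZl fZ IHa.
- by move=> a b IHa IHb m; rewrite !nactA IHa IHb.
Qed.

Definition leavitt_khom : khom M N := KHom fD fZ leavitt_khomA.

End KHomOfGenerators.

End LeavittTheory.

(** * Modules with scalars: submodules, lifts and unital parts *)

Section KModuleTheory.
Variables (K : fieldType) (A : nualgType K) (luA : left_units A).
Local Notation k_of := (kmod_of luA).

Lemma khom0 (M N : kmodule A) (f : khom M N) : f 0 = 0.
Proof. by apply: (addrI (f 0)); rewrite -khomD !addr0. Qed.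

Lemma khomN (M N : kmodule A) (f : khom M N) m : f (- m) = - f m.
Proof. by apply: (addrI (f m)); rewrite -khomD !subrr khom0. Qed.

Lemma khom_has_unit (M N : kmodule A) (f : khom M N) m :
  has_unit m -> has_unit (f m).
Proof. by move=> [u um]; exists u; rewrite -khomA um. Qed.

Definition khom_of (M N : umodule A) (f : umod_hom M N) : khom (k_of M) (k_of N) :=
  @KHom K A (k_of M) (k_of N) f (umod_homD f) (uscal_hom luA f) (umod_homZ f).

Definition umod_hom_of (M N : umodule A) (f : khom (k_of M) (k_of N)) :
  umod_hom M N := @UModHom A M N f (khomD f) (khomA f).

Definition khom_comp (M N P : kmodule A) (g : khom N P) (f : khom M N) : khom M P.
Proof.
by exists (fun m => g (f m)) => *; rewrite ?khomD ?khomZ ?khomA.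
Defined.

Definition kpreim (M N : kmodule A) (f : khom M N) (S : submod N) : submod M.
Proof.
exists (fun m => S (f m)) => [|m n Sm Sn|m Sm|a m Sm].
- by rewrite khom0; exact: smem0.
- by rewrite khomD; exact: smemD.
- by rewrite khomN; exact: smemN.
- by rewrite khomA; exact: smemA.
Defined.

Definition kimage (M N : kmodule A) (f : khom M N) (S : submod M) : submod N.
Proof.
exists (fun n => exists m, S m /\ f m = n).
- by exists 0; split; [exact: smem0|exact: khom0].
- move=> _ _ [m [Sm <-]] [n [Sn <-]]; exists (m + n).
  by split; [exact: smemD|exact: khomD].
- by move=> _ [m [Sm <-]]; exists (- m); split; [exact: smemN|exact: khomN].
- by move=> a _ [m [Sm <-]]; exists (nact a m); split; [exact: smemA|exact: khomA].
Defined.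

Definition kequalizer (M N : kmodule A) (f g : khom M N) : submod M.
Proof.
exists (fun m => f m = g m) => [|m n em en|m em|a m em].
- by rewrite !khom0.
- by rewrite !khomD em en.
- by rewrite !khomN em.
- by rewrite !khomA em.
Defined.

Section Sub.
Variables (M : kmodule A) (S : submod M).
Hypothesis hS : forall m, S m -> has_unit m.

Lemma val_uscal (k : K) (x : sub_umod hS) :
  val (uscal luA k x) = ksc M k (val x).
Proof.
have [u ux] := umod_has_unit luA x.
by rewrite (uscalE luA k ux) /= kactZl -{2}ux.
Qed.

Definition sub_val_khom : khom (k_of (sub_umod hS)) M :=
  @KHom K A (k_of (sub_umod hS)) M val (raddfD val) val_uscal (fun _ _ => erefl).

Definition sub_lift (W : umodule A) (f : khom (k_of W) M) (fS : forall w, S (f w)) :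
  umod_hom W (sub_umod hS).
Proof.
exists (fun w => in_sub (fS w)) => [v w|a w]; apply: val_inj.
  by rewrite raddfD /= khomD.
by rewrite /= -khomA.
Defined.

End Sub.

(** This is the submodule [A M], the largest unital one; maps from unital modules land in it. *)
Definition unit_part (M : nmodule A) : submod M :=
  SubMod (has_unit0 M) (@has_unitD A M luA) (@has_unitN A M)
    (fun a m _ => has_unit_act luA a m).

Definition upart (M : kmodule A) : umodule A :=
  @sub_umod A M (unit_part M) (fun _ => id).

Definition upart_val (M : kmodule A) : khom (k_of (upart M)) M :=
  sub_val_khom (S := unit_part M) (fun _ => id).

Definition upart_lift (W : umodule A) (M : kmodule A) (f : khom (k_of W) M) :
  umod_hom W (upart M) :=
  @sub_lift M (unit_part M) (fun _ => id) W f
    (fun w => khom_has_unit f (umod_has_unit luA w)).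

Definition upart_map (M N : kmodule A) (f : khom M N) : umod_hom (upart M)
  (upart N) :=
  upart_lift (khom_comp f (upart_val M)).

Section UModOfKMod.
Variables (M : kmodule A) (hM : forall m : M, has_unit m).

Lemma kmod_unital (m : M) :
  exists s : seq (A * M), m = \sum_(x <- s) nact x.1 x.2.
Proof. by have [u um] := hM m; exists [:: (u, m)]; rewrite big_seq1. Qed.

Definition umod_of_kmod : umodule A :=
  UModule (@nactDl A M) (@nactDr A M) (@nactA A M) kmod_unital.

End UModOfKMod.
End KModuleTheory.

(** Used to compare the sums in (CK2) over a graph and over a subgraph, when the edges outside the
    subgraph contribute nothing. *)
Lemma sum_inj_image (S T : choiceType) (h : S -> T) (A : set S) (B : set T)
    (V : zmodType) (F : T -> V) :
  injective h -> finite_set B -> (forall s, A s <-> B (h s)) ->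
  (forall t, B t -> (forall s, h s <> t) -> F t = 0) ->
  \sum_(t <- fset_set B) F t = \sum_(s <- fset_set A) F (h s).
Proof.
move=> hinj finB AB F0.
have finA : finite_set A.
  have -> : A = h @^-1` B by apply/seteqP; split=> s /AB.
  by apply: finite_preimage => // x y _ _; exact: hinj.
rewrite -(big_map h xpredT F) (bigID (mem [seq h s | s <- fset_set A])) /=.
rewrite [X in _ + X]big_seq_cond [X in _ + X]big1 ?addr0; last first.
  move=> t /andP[]; rewrite in_fset_set // => /set_mem Bt nt; apply: F0 => // s st.
  move/negP: nt; apply; apply/mapP; exists s => //.
  by rewrite in_fset_set //; apply/mem_set/AB; rewrite st.
rewrite -big_filter; apply: perm_big; apply: uniq_perm.
- by rewrite filter_uniq // fset_uniq.
- by rewrite map_inj_uniq // fset_uniq.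
move=> t; rewrite mem_filter; apply/andP/idP => [[]//|ht]; split=> //.
move: ht => /mapP[s]; rewrite !in_fset_set // => /set_mem As ->.
by apply/mem_set/AB.
Qed.

(** Treats E_H and E/X alike. They differ in which edges of [E] come from the subgraph: those
    starting at one of its vertices for E_H, those ending at one for E/X. *)
Record embedding (G E : graph) := Embedding {
  vmap : vertex G -> vertex E;
  emap : edge G -> edge E;
  vmap_inj : injective vmap;
  emap_inj : injective emap;
  src_emap : forall e, src (emap e) = vmap (src e);
  tgt_emap : forall e, tgt (emap e) = vmap (tgt e) }.

Lemma out_edges_emap (G E : graph) (i : embedding G E) v e :
  out_edges v e <-> out_edges (vmap i v) (emap i e).
Proof. by rewrite /out_edges /= src_emap; split=> [->|/vmap_inj]. Qed.

Lemma sink_vmap (G E : graph) (i : embedding G E) v : sink (vmap i v) -> sink v.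
Proof.
by move=> sv; rewrite /sink -subset0 => e /(out_edges_emap i); rewrite sv.
Qed.

Definition gmap (G E : graph) (i : embedding G E) (x : lpa_gen G) : lpa_gen E :=
  match x with
  | gen_vertex v => gen_vertex (vmap i v)
  | gen_edge e => gen_edge (emap i e)
  | gen_ghost e => gen_ghost (emap i e)
  end.

Lemma gmap_inj (G E : graph) (i : embedding G E) : injective (gmap i).
Proof.
by case=> [v|e|e] [w|f|f] //= []; [move/vmap_inj->|move/emap_inj->|move/emap_inj->].
Qed.

Local Notation lu := (@leavitt_left_units _ _).
Local Notation k_of := (kmod_of lu).
Arguments lv {K E} v.
Arguments le {K E} e.
Arguments lg {K E} e.

(** * Restricting an action to a subgraph *)

Section Restrict.
Variables (K : fieldType) (G E : graph) (i : embedding G E).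

(** Of the defining relations only (CK2) depends on which edges leave a vertex; the others are
    inherited by every subgraph. *)
Definition ck_restricts (M : nmodule (leavitt K E)) : Prop :=
  forall (v : vertex G) (m : M), finite_set (out_edges v) -> ~ sink v ->
  nact (lv (vmap i v)) m =
  \sum_(e <- fset_set (out_edges v)) nact (le (emap i e)) (nact (lg (emap i e)) m).

Variables (M : kmodule (leavitt K E)) (ckM : ck_restricts M).

Definition restrict_family : lfamily G (ksc M).
Proof.
exists (fun x m => nact (lgen K (gmap i x)) m) => /=.
- by move=> x m n; exact: nactDr.
- by move=> x k m; exact: kactZr.
- by move=> v m; exact: act_vv.
- by move=> v w m vw; apply: act_vw => /vmap_inj.
- by move=> e m; rewrite -src_emap; exact: act_se.
- by move=> e m; rewrite -tgt_emap; exact: act_er.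
- by move=> e m; rewrite -tgt_emap; exact: act_re.
- by move=> e m; rewrite -src_emap; exact: act_es.
- by move=> e m; rewrite -tgt_emap; exact: act_ee.
- by move=> e f m ef; apply: act_ef => /emap_inj.
- exact: ckM.
Defined.

Definition restrict_kmod : kmodule (leavitt K G) := family_kmod restrict_family.

Lemma restrictE x (m : M) :
  nact (lgen K x) (m : restrict_kmod) = nact (lgen K (gmap i x)) m.
Proof. exact: family_actE. Qed.

(** Stands in for a homomorphism from L(G) to L(E); it carries units for the restricted module over
    to [M]. *)
Lemma restrict_act (b : leavitt K G) :
  exists a : leavitt K E, forall m : M, nact b (m : restrict_kmod) = nact a m.
Proof.
elim/presented_ind: b.
- by move=> x; exists (lgen K (gmap i x)) => m; exact: restrictE.
- by exists 0 => m; rewrite !nact0l.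
- move=> b c [b' bE] [c' cE]; exists (b' + c') => m.
  by rewrite !nactDl -bE -cE.
- by move=> b [b' bE]; exists (- b') => m; rewrite !nactNl -bE.
- by move=> k b [b' bE]; exists (k *: b') => m; rewrite !kactZl -bE.
- move=> b c [b' bE] [c' cE]; exists (rmul b' c') => m.
  by rewrite !nactA -cE -bE.
Qed.

End Restrict.

Definition restrict_khom (K : fieldType) (G E : graph) (i : embedding G E)
    (M N : kmodule (leavitt K E)) (ckM : ck_restricts i M) (ckN : ck_restricts i N)
    (f : khom M N) : khom (restrict_kmod ckM) (restrict_kmod ckN).
Proof.
apply: (@leavitt_khom K G (restrict_kmod ckM) (restrict_kmod ckN) f).
- by move=> m n; exact: (khomD f m n).
- by move=> k m; exact: (khomZ f k m).
- by move=> x m; rewrite !restrictE khomA.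
Defined.

(** * Extending an action by zero *)

Section ExtendAction.
Variables (K : fieldType) (G E : graph) (i : embedding G E).
Variable (M : kmodule (leavitt K G)).

(** As [gmap] is injective, the chosen preimage is the only one. *)
Definition ext (x : lpa_gen E) (m : M) : M :=
  if pselect (exists y, gmap i y = x) is left h
  then nact (lgen K (projT1 (cid h))) m else 0.

Lemma ext_gmap y m : ext (gmap i y) m = nact (lgen K y) m.
Proof.
rewrite /ext; case: pselect => [h|[]]; last by exists y.
by case: cid => z /= /gmap_inj ->.
Qed.

Lemma ext_notin x m : (forall y, gmap i y <> x) -> ext x m = 0.
Proof. by move=> nx; rewrite /ext; case: pselect => // h; have [y /nx] := h. Qed.

Lemma extD x m n : ext x (m + n) = ext x m + ext x n.
Proof. by rewrite /ext; case: pselect => *; rewrite ?addr0 ?nactDr. Qed.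

Lemma ext0 x : ext x 0 = 0.
Proof. by rewrite /ext; case: pselect => *; rewrite ?nact0r. Qed.

Lemma extZ x k m : ext x (ksc M k m) = ksc M k (ext x m).
Proof.
by rewrite /ext; case: pselect => *; rewrite ?kactZr ?(scal0 (ksc M)).
Qed.

Lemma ext_vmap w m : ext (gen_vertex (vmap i w)) m = nact (lv w) m.
Proof. exact: (ext_gmap (gen_vertex w)). Qed.

Lemma ext_emap e m : ext (gen_edge (emap i e)) m = nact (le e) m.
Proof. exact: (ext_gmap (gen_edge e)). Qed.

Lemma ext_gemap e m : ext (gen_ghost (emap i e)) m = nact (lg e) m.
Proof. exact: (ext_gmap (gen_ghost e)). Qed.

Lemma ext_v0 v m : (forall w, vmap i w <> v) -> ext (gen_vertex v) m = 0.
Proof. by move=> nv; apply: ext_notin => -[w|e|e] // [] /nv. Qed.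

Lemma ext_e0 e m : (forall e', emap i e' <> e) -> ext (gen_edge e) m = 0.
Proof. by move=> ne; apply: ext_notin => -[w|e'|e'] // [] /ne. Qed.

Lemma ext_g0 e m : (forall e', emap i e' <> e) -> ext (gen_ghost e) m = 0.
Proof. by move=> ne; apply: ext_notin => -[w|e'|e'] // [] /ne. Qed.

Lemma vmapP v : (exists w, vmap i w = v) \/ (forall w, vmap i w <> v).
Proof.
have [?|/forallNP ?] := pselect (exists w, vmap i w = v); [by left|by right].
Qed.

Lemma emapP e : (exists e', emap i e' = e) \/ (forall e', emap i e' <> e).
Proof.
have [?|/forallNP ?] := pselect (exists e', emap i e' = e); [by left|by right].
Qed.

(** This and the next relations hold for every embedding. Missing is [e^* e = r(e)], which can fail
    at an edge outside the subgraph that ends at one of its vertices. *)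
Lemma ext_vv v m : ext (gen_vertex v) (ext (gen_vertex v) m) = ext (gen_vertex v) m.
Proof.
have [[w <-]|nv] := vmapP v; last by rewrite ext_v0 // ext_v0.
by rewrite !ext_vmap act_vv.
Qed.

Lemma ext_vw v w m : v <> w -> ext (gen_vertex v) (ext (gen_vertex w) m) = 0.
Proof.
have [[v' <-]|nv] := vmapP v; last by rewrite ext_v0.
have [[w' <-]|nw] := vmapP w; last by rewrite (ext_v0 _ nw) ext0.
by move=> vw; rewrite !ext_vmap act_vw // => vw'; apply: vw; rewrite vw'.
Qed.

Lemma ext_se e m : ext (gen_vertex (src e)) (ext (gen_edge e) m) = ext
  (gen_edge e) m.
Proof.
have [[e' <-]|ne] := emapP e; last by rewrite ext_e0 // ext0.
by rewrite src_emap ext_vmap !ext_emap act_se.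
Qed.

Lemma ext_er e m : ext (gen_edge e) (ext (gen_vertex (tgt e)) m) = ext
  (gen_edge e) m.
Proof.
have [[e' <-]|ne] := emapP e; last by rewrite !ext_e0.
by rewrite tgt_emap ext_vmap !ext_emap act_er.
Qed.

Lemma ext_re e m : ext (gen_vertex (tgt e)) (ext (gen_ghost e) m) = ext
  (gen_ghost e) m.
Proof.
have [[e' <-]|ne] := emapP e; last by rewrite ext_g0 // ext0.
by rewrite tgt_emap ext_vmap !ext_gemap act_re.
Qed.

Lemma ext_es e m : ext (gen_ghost e) (ext (gen_vertex (src e)) m) = ext
  (gen_ghost e) m.
Proof.
have [[e' <-]|ne] := emapP e; last by rewrite !ext_g0.
by rewrite src_emap ext_vmap !ext_gemap act_es.
Qed.

Lemma ext_ef e f m : e <> f -> ext (gen_ghost e) (ext (gen_edge f) m) = 0.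
Proof.
have [[e' <-]|ne] := emapP e; last by rewrite !ext_g0.
have [[f' <-]|nf] := emapP f; last by rewrite (ext_e0 _ nf) ext0.
by move=> ef; rewrite ext_gemap ext_emap act_ef // => ef'; apply: ef; rewrite ef'.
Qed.

(** The edges outside the image contribute zero, which leaves (CK2) in [G]. At a sink of [G] that
    emits edges in [E] the equation would say that the vertex acts as zero, hence the second
    hypothesis. *)
Lemma ext_ck2 w m : finite_set (out_edges (vmap i w)) -> ~ sink w ->
  ext (gen_vertex (vmap i w)) m =
  \sum_(e <- fset_set (out_edges (vmap i w)))
     ext (gen_edge e) (ext (gen_ghost e) m).
Proof.
move=> finw sw.
have wE := out_edges_emap i w.
rewrite (sum_inj_image (@emap_inj _ _ i) finw wE); last first.
  by move=> e _ ne; rewrite ext_e0.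
rewrite ext_vmap act_ck2 //.
  by apply: eq_bigr => e _; rewrite ext_emap ext_gemap.
have -> : out_edges w = emap i @^-1` out_edges (vmap i w).
  by apply/seteqP; split=> e /wE.
by apply: finite_preimage => // x y _ _; exact: emap_inj.
Qed.

End ExtendAction.

(** * Modules over the quotient graph *)

Lemma inj_surj_bij (S T : Type) (f : S -> T) :
  injective f -> (forall y, exists x, f x = y) -> bijective f.
Proof.
move=> finj fsurj; pose g y := projT1 (cid (fsurj y)).
have gE y : f (g y) = y by rewrite /g; case: cid.
by exists g => // x; apply: finj; rewrite gE.
Qed.

(** Taken as an intersection, so that induction on generation is the application to a suitable
    submodule, such as a preimage or an equalizer. *)
Definition generated (A : rngType) (M : nmodule A) (X : M -> Prop) : submod M.
Proof.
exists (fun m => forall S : submod M, (forall x, X x -> S x) -> S m).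
- by move=> S _; exact: smem0.
- by move=> m n hm hn S XS; apply: smemD; [exact: hm|exact: hn].
- by move=> m hm S XS; apply: smemN; exact: hm.
- by move=> a m hm S XS; apply: smemA; exact: hm.
Defined.

Lemma generated_sub (A : rngType) (M : nmodule A) (X : M -> Prop) m :
  X m -> generated X m.
Proof. by move=> Xm S; exact. Qed.

Section QuotientSide.
Variables (K : fieldType) (Q E : graph) (i : embedding Q E).
Hypothesis row_finE : row_finite E.
Hypothesis edge_in : forall e w, tgt e = vmap i w -> exists e', emap i e' = e.
Hypothesis sink_in : forall w, sink w -> sink (vmap i w).

Local Notation LE := (leavitt K E).
Local Notation LQ := (leavitt K Q).

Definition null (M : nmodule LE) : Prop :=
  forall v, (forall w, vmap i w <> v) -> forall m : M, nact (lv v) m = 0.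

Lemma tgt_notin e : (forall e', emap i e' <> e) -> forall w, vmap i w <> tgt e.
Proof. by move=> ne w we; have [e' /ne] := edge_in (esym we). Qed.

(** An edge outside the image ends outside it, and both [e = e r(e)] and [e^* = r(e) e^*] factor
    through the range. *)
Lemma null_gen (M : nmodule LE) (nM : null M) x (m : M) :
  (forall y, gmap i y <> x) -> nact (lgen K x) m = 0.
Proof.
case: x => [v|e|e] nx.
- by apply: nM => w wv; apply: (nx (gen_vertex w)); rewrite /= wv.
- rewrite -[lgen _ _]/(le e) -act_er nM ?nact0r //.
  by apply: tgt_notin => e' ee; apply: (nx (gen_edge e')); rewrite /= ee.
- rewrite -[lgen _ _]/(lg e) -act_re nM //.
  by apply: tgt_notin => e' ee; apply: (nx (gen_ghost e')); rewrite /= ee.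
Qed.

Lemma null_ck_restricts (M : nmodule LE) : null M -> ck_restricts i M.
Proof.
move=> nM v m fv sv.
rewrite act_ck2; [|exact: row_finE|by move=> /sink_vmap].
rewrite (sum_inj_image (@emap_inj _ _ i) (@row_finE _) (out_edges_emap i v)) //
  => e _ ne.
by rewrite -[nact (lg e) m]act_re nM ?nact0r //; exact: tgt_notin.
Qed.

Definition null_kmod (M : kmodule LE) (nM : null M) : kmodule LQ :=
  restrict_kmod (null_ck_restricts nM).

Definition ext_family (Y : kmodule LQ) : lfamily E (ksc Y).
Proof.
exists (ext i (M := Y)).
- exact: extD.
- exact: extZ.
- exact: ext_vv.
- exact: ext_vw.
- exact: ext_se.
- exact: ext_er.
- exact: ext_re.
- exact: ext_es.
(* An edge outside the image ends outside it by [edge_in], so both sides are zero in that case. *)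
- move=> e m; have [[e' <-]|ne] := emapP i e.
    by rewrite tgt_emap ext_gemap ext_emap ext_vmap act_ee.
  by rewrite ext_g0 // ext_v0 //; exact: tgt_notin.
- exact: ext_ef.
(* At a vertex of [Q] the hypothesis [sink_in] excludes a sink of [Q], as [ext_ck2] requires; at any
   other vertex all emitted edges lie outside the image. *)
- move=> v m fv sv; have [[w wv]|nv] := vmapP i v.
    by subst v; apply: ext_ck2 => // /sink_in.
  rewrite ext_v0 // big_seq big1 // => e; rewrite in_fset_set // => /set_mem ev.
  rewrite ext_e0 // => e' ee; apply: (nv (src e')); rewrite -src_emap ee.
  exact: ev.
Defined.

Definition ext_kmod (Y : kmodule LQ) : kmodule LE := family_kmod (ext_family Y).

Lemma ext_kmodE (Y : kmodule LQ) x (y : Y) :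
  nact (lgen K x) (y : ext_kmod Y) = ext i x y.
Proof. exact: family_actE. Qed.

Lemma ext_null (Y : kmodule LQ) : null (ext_kmod Y).
Proof.
move=> v nv m; rewrite [LHS](ext_kmodE (gen_vertex v)).
exact: (@ext_v0 K Q E i Y v m nv).
Qed.

(* Serves as a surrogate for the projection L(E) -> L(Q): linearity of maps is
   transported along it in both directions. *)
Definition match_act (a : LE) (b : LQ) : Prop :=
  (forall (M : kmodule LE) (nM : null M) (m : M),
     nact b (m : null_kmod nM) = nact a m) /\
  (forall (Y : kmodule LQ) (y : Y), nact a (y : ext_kmod Y) = nact b y).

Lemma match_gen y : match_act (lgen K (gmap i y)) (lgen K y).
Proof.
split=> [M nM m|Y m]; first by rewrite [LHS]restrictE.
by rewrite ext_kmodE ext_gmap.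
Qed.

Lemma match0 : match_act 0 0.
Proof. by split=> *; rewrite !nact0l. Qed.

Lemma matchD a b a' b' :
  match_act a b -> match_act a' b' -> match_act (a + a') (b + b').
Proof.
move=> [ab1 ab2] [ab1' ab2']; split=> [M nM m|Y y].
  by rewrite !nactDl ab1 ab1'.
by rewrite !nactDl ab2 ab2'.
Qed.

Lemma matchN a b : match_act a b -> match_act (- a) (- b).
Proof.
move=> [ab1 ab2]; split=> [M nM m|Y y].
  by rewrite !nactNl ab1.
by rewrite !nactNl ab2.
Qed.

Lemma matchZ k a b : match_act a b -> match_act (k *: a) (k *: b).
Proof.
move=> [ab1 ab2]; split=> [M nM m|Y y].
  by rewrite !kactZl ab1.
by rewrite !kactZl ab2.
Qed.

Lemma matchM a b a' b' :
  match_act a b -> match_act a' b' -> match_act (rmul a a') (rmul b b').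
Proof.
move=> [ab1 ab2] [ab1' ab2']; split=> [M nM m|Y y].
  by rewrite !nactA ab1' ab1.
by rewrite !nactA ab2' ab2.
Qed.

Lemma match_right (a : LE) : exists b, match_act a b.
Proof.
elim/presented_ind: a.
- move=> x; have [[y <-]|/forallNP nx] := pselect (exists y, gmap i y = x).
    by exists (lgen K y); exact: match_gen.
  exists 0; split=> [M nM m|Y y]; first by rewrite nact0l [RHS]null_gen.
  by rewrite nact0l [LHS]null_gen //; exact: ext_null.
- by exists 0; exact: match0.
- by move=> a a' [b ab] [b' ab']; exists (b + b'); exact: matchD.
- by move=> a [b ab]; exists (- b); exact: matchN.
- by move=> k a [b ab]; exists (k *: b); exact: matchZ.
- by move=> a a' [b ab] [b' ab']; exists (rmul b b'); exact: matchM.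
Qed.

Lemma match_left (b : LQ) : exists a, match_act a b.
Proof.
elim/presented_ind: b.
- by move=> y; exists (lgen K (gmap i y)); exact: match_gen.
- by exists 0; exact: match0.
- by move=> b b' [a ab] [a' ab']; exists (a + a'); exact: matchD.
- by move=> b [a ab]; exists (- a); exact: matchN.
- by move=> k b [a ab]; exists (k *: a); exact: matchZ.
- by move=> b b' [a ab] [a' ab']; exists (rmul a a'); exact: matchM.
Qed.

Lemma ext_has_unit (Y : umodule LQ) (y : ext_kmod (k_of Y)) : has_unit y.
Proof.
have [b yb] := umod_has_unit lu (y : Y); have [a [_ ab]] := match_left b.
by exists a; rewrite ab.
Qed.

Definition ext_umod (Y : umodule LQ) : umodule LE :=
  umod_of_kmod (@ext_has_unit Y).

Lemma null_has_unit (M : umodule LE) (nM : null (k_of M)) (m : null_kmod nM) :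
  has_unit m.
Proof.
have [a ma] := umod_has_unit lu (m : M); have [b [ab _]] := match_right a.
by exists b; rewrite ab.
Qed.

Definition null_umod (M : umodule LE) (nM : null M) : umodule LQ :=
  umod_of_kmod (@null_has_unit M nM).

Lemma match_null a b : match_act a b -> forall (M : umodule LE) (nM : null M)
  (m : M),
  act b (m : null_umod nM) = act a m.
Proof. by move=> [ab _] M nM m; exact: (ab (k_of M) nM m). Qed.

Lemma match_ext a b : match_act a b -> forall (Y : umodule LQ) (y : Y),
  act a (y : ext_umod Y) = act b y.
Proof. by move=> [_ ab] Y y; exact: (ab (k_of Y) y). Qed.

Lemma ext_umod_null (Y : umodule LQ) : null (ext_umod Y).
Proof. exact: ext_null. Qed.

Section Transport.
Variables (Y Y' : umodule LQ) (M M' : umodule LE) (nM : null M) (nM' : null M').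

(** Carriers and underlying functions stay the same in this section; [match_right] and [match_left]
    only transport linearity. This is why the functor i is fully faithful. *)
Definition ext_hom (f : umod_hom Y Y') : umod_hom (ext_umod Y) (ext_umod Y').
Proof.
apply: (@UModHom LE (ext_umod Y) (ext_umod Y') (@umod_fun _ _ _ f)) =>
  [m n|a m]; first exact: (umod_homD f).
by have [b ab] := match_right a; rewrite !(match_ext ab) umod_homZ.
Defined.

Definition hom_ext (f : umod_hom (ext_umod Y) (ext_umod Y')) : umod_hom Y Y'.
Proof.
apply: (@UModHom LQ (Y) (Y') (@umod_fun _ _ _ f)) => [m n|b m];
  first exact: (umod_homD f).
by have [a ab] := match_left b; rewrite -!(match_ext ab) umod_homZ.
Defined.

Definition null_hom (f : umod_hom M M') : umod_hom (null_umod nM) (null_umod nM').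
Proof.
apply: (@UModHom LQ (null_umod nM) (null_umod nM') (@umod_fun _ _ _ f)) =>
  [m n|b m]; first exact: (umod_homD f).
by have [a ab] := match_left b; rewrite !(match_null ab) umod_homZ.
Defined.

Definition ext_to_null (f : umod_hom (ext_umod Y) M) : umod_hom Y (null_umod nM).
Proof.
apply: (@UModHom LQ (Y) (null_umod nM) (@umod_fun _ _ _ f)) => [m n|b m];
  first exact: (umod_homD f).
by have [a ab] := match_left b; rewrite [RHS](match_null ab) -[RHS](umod_homZ f
  a m) (match_ext ab).
Defined.

Definition ext_of_null (f : umod_hom Y (null_umod nM)) : umod_hom (ext_umod Y) M.
Proof.
apply: (@UModHom LE (ext_umod Y) (M) (@umod_fun _ _ _ f)) => [m n|a m];
  first exact: (umod_homD f).
by have [b ab] := match_right a; rewrite (match_ext ab) [LHS](umod_homZ f b m)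
  (match_null ab).
Defined.

Definition null_to_ext (f : umod_hom (null_umod nM) Y) : umod_hom M (ext_umod Y).
Proof.
apply: (@UModHom LE (M) (ext_umod Y) (@umod_fun _ _ _ f)) => [m n|a m];
  first exact: (umod_homD f).
by have [b ab] := match_right a; rewrite [RHS](match_ext ab) -[RHS](umod_homZ f
  b m) (match_null ab).
Defined.

Definition null_of_ext (f : umod_hom M (ext_umod Y)) : umod_hom (null_umod nM) Y.
Proof.
apply: (@UModHom LQ (null_umod nM) (Y) (@umod_fun _ _ _ f)) => [m n|b m];
  first exact: (umod_homD f).
by have [a ab] := match_left b; rewrite -[RHS](match_ext ab) -[RHS](umod_homZ f
  a m) (match_null ab).
Defined.

End Transport.

Definition functor_i : functor (Mod LQ) (Mod LE).
Proof.
exists (ext_umod : Mod LQ -> Mod LE) ext_hom => *; exact: umod_hom_eq.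
Defined.

Lemma functor_i_ff : fully_faithful functor_i.
Proof.
by move=> X Y; exists (@hom_ext X Y) => f; apply: umod_hom_eq.
Qed.

(** * The largest submodule and the largest quotient that come from the quotient graph *)

Section NullSub.
Variable M : umodule LE.

(** Quantifying over [a] makes the condition stable under the action; taking for [a] a unit of [m]
    gives back the condition on [m] itself. *)
Definition null_sub : submod M.
Proof.
exists (fun m => forall a v, (forall w, vmap i w <> v) ->
  nact (lv v) (nact a m) = 0).
- by move=> a v nv; rewrite !nact0r.
- by move=> m n hm hn a v nv; rewrite !nactDr hm // hn // addr0.
- by move=> m hm a v nv; rewrite !nactNr hm // oppr0.
- by move=> b m hm a v nv; rewrite -(nactA a); exact: hm.
Defined.

Lemma null_subP : null (submod_umod lu null_sub).
Proof.
move=> v nv x; apply: val_inj => /=; have hx := sub_valP x.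
by have [u <-] := umod_has_unit lu (val x); exact: hx.
Qed.

Definition nonnull : submod M :=
  generated (fun m => exists v n, (forall w, vmap i w <> v) /\ m = nact (lv v) n).

Lemma nonnullP : null (quot_umod nonnull).
Proof.
move=> v nv x; have [m <-] := quot_proj_surj x.
rewrite [LHS](quot_actE nonnull (lv v) m); apply/(quot_projP nonnull).
by apply: generated_sub; exists v, m.
Qed.

End NullSub.

Definition p_obj (M : umodule LE) : umodule LQ := null_umod (@null_subP M).
Definition q_obj (M : umodule LE) : umodule LQ := null_umod (@nonnullP M).

Definition null_sub_map (M N : umodule LE) (f : umod_hom M N) :
  umod_hom (submod_umod lu (null_sub M)) (submod_umod lu (null_sub N)).
Proof.
apply: (@sub_lift K LE lu (k_of N) (null_sub N) _ _
  (khom_of lu (umod_comp f (sub_incl lu (null_sub M))))).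
move=> x a v nv; have /= := sub_valP x a v nv.
by rewrite -!umod_homZ => ->; rewrite umod_hom0.
Defined.

Definition functor_p : functor (Mod LE) (Mod LQ).
Proof.
exists (p_obj : Mod LE -> Mod LQ)
  (fun M N f => null_hom (@null_subP M) (@null_subP N) (null_sub_map f)).
- by move=> M; apply: umod_hom_eq => x; apply: val_inj.
- by move=> M N P g f; apply: umod_hom_eq => x; apply: val_inj.
Defined.

(** The preimage of [nonnull N] under [f] is a submodule, so it is enough to treat the generators
    [v n], and [f] sends these to generators. *)
Lemma nonnull_hom (M N : umodule LE) (f : umod_hom M N) m :
  nonnull M m -> nonnull N (f m).
Proof.
apply: (_ : _ -> @kpreim K LE (k_of M) (k_of N) (khom_of lu f) (nonnull N) m);
  apply=> _ [v [n [nv ->]]].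
by apply: generated_sub; exists v, (f n); split=> //; exact: umod_homZ.
Qed.

Section QuotMap.
Variables (M N : umodule LE) (f : umod_hom M N).

Definition quot_fun (x : quot_umod (nonnull M)) : quot_umod (nonnull N) :=
  to_quot (nonnull N) (f (repr x)).

Lemma quot_funE m : quot_fun (quot_proj _ m) = quot_proj _ (f m).
Proof.
apply/(to_quot_eq (nonnull N)).
by rewrite -umod_homB; apply: nonnull_hom; exact: repr_to_quot.
Qed.

Lemma quot_funD x y : quot_fun (x + y) = quot_fun x + quot_fun y.
Proof.
have [m <-] := quot_proj_surj x; have [n <-] := quot_proj_surj y.
by rewrite -umod_homD !quot_funE !umod_homD.
Qed.

Lemma quot_funZ a x : quot_fun (act a x) = act a (quot_fun x).
Proof.
have [m <-] := quot_proj_surj x.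
by rewrite -umod_homZ !quot_funE !umod_homZ.
Qed.

Definition quot_map : umod_hom (quot_umod (nonnull M)) (quot_umod (nonnull N)) :=
  UModHom quot_funD quot_funZ.

End QuotMap.

Definition functor_q : functor (Mod LE) (Mod LQ).
Proof.
exists (q_obj : Mod LE -> Mod LQ)
  (fun M N f => null_hom (@nonnullP M) (@nonnullP N) (quot_map f)).
- move=> M; apply: umod_hom_eq => x; have [m <-] := quot_proj_surj x.
  exact: quot_funE.
- move=> M N P g f; apply: umod_hom_eq => x; have [m <-] := quot_proj_surj x.
  by rewrite [LHS](quot_funE (umod_comp g f) m) -[LHS](quot_funE g) -(quot_funE f).
Defined.

(** The bijection is composition with the quotient map. A homomorphism into an extended module kills
    every generator of [nonnull M], so it factors through the quotient. *)
Lemma adj_qi : left_adjoint functor_q functor_i.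
Proof.
exists (fun (M : umodule LE) (Y : umodule LQ) (f : umod_hom (q_obj M) Y) =>
  umod_comp (null_to_ext f) (quot_proj (nonnull M))); split; last first.
  move=> M M' Y Y' a b f; apply: umod_hom_eq => m.
  by rewrite /= [X in f X]quot_funE.
move=> M Y; apply: inj_surj_bij => [f g fg|h].
  apply: umod_hom_eq => x; have [m <-] := quot_proj_surj x.
  exact: (congr1 (fun k : umod_hom M (ext_umod Y) => k m) fg).
have [//|m|u uE] := @quot_factor _ _ _ _ (quot_proj (nonnull M)) h.
- exact: quot_proj_surj.
- move=> /quot_projP; apply: (_ : _ -> ker_submod h m); apply=> _ [v [n [nv ->]]].
  by rewrite /= [LHS](umod_homZ h); exact: ext_umod_null.
by exists (null_of_ext (@nonnullP M) u); apply: umod_hom_eq => m; exact: uE.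
Qed.

Lemma null_sub_image (Y : umodule LQ) (M : umodule LE)
  (f : umod_hom (ext_umod Y) M) y : null_sub M (f y).
Proof.
move=> a v nv; rewrite -[nact a _](umod_homZ f a y) -[LHS](umod_homZ f (lv v)).
by rewrite [act _ _](ext_umod_null nv) umod_hom0.
Qed.

Lemma adj_ip : left_adjoint functor_i functor_p.
Proof.
pose phi (Y : umodule LQ) (M : umodule LE) (f : umod_hom (ext_umod Y) M) :
    umod_hom Y (p_obj M) :=
  ext_to_null (@null_subP M) (@sub_lift K LE lu (k_of M) (null_sub M) 
    (fun m _ => umod_has_unit lu (m : M)) _ (khom_of lu f) (null_sub_image f)).
exists phi; split; last first.
  by move=> Y Y' M M' a b f; apply: umod_hom_eq => y; apply: val_inj.
move=> Y M; apply: inj_surj_bij => [f g fg|h].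
  apply: umod_hom_eq => y.
  exact: (congr1 (fun k : umod_hom Y (p_obj M) => sub_val (k y)) fg).
exists (umod_comp (sub_incl lu (null_sub M)) (ext_of_null h)).
by apply: umod_hom_eq => y; apply: val_inj.
Qed.

(** Being null passes along isomorphisms. Conversely, a null module can be restricted to [Q] and
    extended back by zero, and the identity function is an isomorphism from the result to the
    original module. *)
Lemma ess_image_null (M : umodule LE) : ess_image functor_i M <-> null M.
Proof.
split=> [[Y [f [g [gf fg]]]] v nv m|nM].
  have fgE x : f (g x) = x by exact: (congr1 (fun h : umod_hom M M => h x) fg).
  rewrite -[LHS]fgE [g _](umod_homZ g (lv v) m).
  by rewrite [act _ _](ext_umod_null nv) umod_hom0.
exists (null_umod nM : Mod LQ).
exists (ext_of_null (umod_id (null_umod nM))), (null_to_ext (umod_id (null_umod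
  nM))).
by split; apply: umod_hom_eq.
Qed.

End QuotientSide.

(** * Modules over the restricted graph *)

Section RestrictionSide.
Variables (K : fieldType) (G E : graph) (i : embedding G E).
Hypothesis row_finE : row_finite E.
Hypothesis out_in : forall e w, src e = vmap i w -> exists e', emap i e' = e.
Hypothesis finG : finite_set [set: vertex G].

Local Notation LE := (leavitt K E).
Local Notation LG := (leavitt K G).

(** Every edge leaving a vertex of [G] belongs to [G], so (CK2) over [E] and over [G] have the same
    terms there. *)
Lemma full_ck_restricts (M : nmodule LE) : ck_restricts i M.
Proof.
move=> v m fv sv.
rewrite act_ck2; [|exact: row_finE|by move=> /sink_vmap].
rewrite (sum_inj_image (@emap_inj _ _ i) (@row_finE _) (out_edges_emap i v)) //
  => e ev ne.
by have [e' /ne] := out_in ev.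
Qed.

Definition res (M : kmodule LE) : kmodule LG :=
  restrict_kmod (@full_ck_restricts M).

Definition res_hom (M N : kmodule LE) (f : khom M N) : khom (res M) (res N) :=
  restrict_khom _ _ f.

Definition jM (M : umodule LE) : umodule LG := upart lu (res (k_of M)).

Definition functor_j : functor (Mod LE) (Mod LG).
Proof.
exists (jM : Mod LE -> Mod LG)
  (fun M N f => upart_map lu (res_hom (khom_of lu f))).
- by move=> M; apply: umod_hom_eq => x; apply: val_inj.
- by move=> M N P g f; apply: umod_hom_eq => x; apply: val_inj.
Defined.

Arguments res : simpl never.
Arguments jM : simpl never.

Definition inI (v : vertex E) : bool := `[< exists w, vmap i w = v >].

Lemma inI_vmap w : inI (vmap i w).
Proof. by apply/asboolP; exists w. Qed.

Lemma inI_src e : inI (src e) -> exists e', emap i e' = e.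
Proof. by move=> /asboolP[w /esym]; exact: out_in. Qed.

(** * The space of functions on paths *)

Section Paths.
Variable N : kmodule LG.
Local Notation hN := (ext i (M := N)).

Lemma ext_gN0 e (n : N) : ~~ inI (src e) -> hN (gen_ghost e) n = 0.
Proof.
by move=> ne; rewrite ext_g0 // => e' ee; move: ne; rewrite -ee src_emap inI_vmap.
Qed.

Lemma ext_eN0 e (n : N) : ~~ inI (src e) -> hN (gen_edge e) n = 0.
Proof.
by move=> ne; rewrite ext_e0 // => e' ee; move: ne; rewrite -ee src_emap inI_vmap.
Qed.

Lemma ext_vN0 v (n : N) : ~~ inI v -> hN (gen_vertex v) n = 0.
Proof. by move=> nv; rewrite ext_v0 // => w wv; move: nv; rewrite -wv inI_vmap. Qed.

Lemma ext_ee e (n : N) : inI (src e) ->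
  hN (gen_ghost e) (hN (gen_edge e) n) = hN (gen_vertex (tgt e)) n.
Proof.
by move=> /inI_src[e' <-]; rewrite ext_gemap ext_emap tgt_emap ext_vmap act_ee.
Qed.

(* A pair [(v, l)] stands for a path [l] starting at [v] and meeting the image
   of [i] only at its end point; [tproj] vanishes if there is no such path, and
   otherwise projects to the component of the end point.  Being part of the
   action [pgenact] below, it dispenses with support conditions on [pfun]. *)
Fixpoint tproj (v : vertex E) (l : seq (edge E)) (n : N) : N :=
  match l with
  | [::] => hN (gen_vertex v) n
  | e :: l' => if (src e == v) && ~~ inI v then tproj (tgt e) l' n else 0
  end.

Lemma tproj_cons v e l n : tproj v (e :: l) n =
  if (src e == v) && ~~ inI v then tproj (tgt e) l n else 0.
Proof. by []. Qed.

Lemma tprojD v l m n : tproj v l (m + n) = tproj v l m + tproj v l n.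
Proof.
elim: l v => [|e l IH] v /=; first exact: extD.
by case: ifP => _; rewrite ?addr0 ?IH.
Qed.

Lemma tproj0 v l : tproj v l 0 = 0.
Proof. by apply: (addrI (tproj v l 0)); rewrite -tprojD !addr0. Qed.

Lemma tprojZ v l k n : tproj v l (ksc N k n) = ksc N k (tproj v l n).
Proof.
elim: l v => [|e l IH] v /=; first exact: extZ.
by case: ifP => _; rewrite ?(scal0 (ksc N)) ?IH.
Qed.

Lemma tproj_idem v l n : tproj v l (tproj v l n) = tproj v l n.
Proof.
elim: l v => [|e l IH] v /=; first exact: ext_vv.
by case: ((src e == v) && ~~ inI v); rewrite ?IH.
Qed.

Definition pfun : zmodType := (vertex E -> seq (edge E) -> N : zmodType).

Implicit Type f : pfun.

Lemma pfunD f g v l : (f + g) v l = f v l + g v l. Proof. by []. Qed.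

Lemma pfun_sum (I : Type) (r : seq I) (F : I -> pfun) v l :
  (\sum_(x <- r) F x) v l = \sum_(x <- r) F x v l.
Proof. by apply: (big_morph (fun f : pfun => f v l)). Qed.

Lemma pfunP f g : (forall v l, f v l = g v l) -> f = g.
Proof. by move=> fg; apply/funext => v; apply/funext => l. Qed.

Definition pscal (k : K) f : pfun := fun v l => ksc N k (f v l).

Definition pscaling : scaling K pfun.
Proof.
exists pscal => [k f g|k l f|k l f|f]; apply: pfunP => v p; rewrite /pscal.
- exact: scalDr.
- exact: scalDl.
- exact: scalA.
- exact: scal1.
Defined.

(** The formulas are dictated by reading [f v l] as [l^* m]: an edge strips itself from the front of
    a path and its ghost prepends it. If the edge starts in the image, only trivial paths are
    involved and the action is that on [N]. In the ghost clause the first summand vanishes if [e]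
    starts in the image, the second if it does not. *)
Definition pgenact (x : lpa_gen E) f : pfun := fun v l =>
  match x with
  | gen_vertex u => if u == v then tproj v l (f v l) else 0
  | gen_edge e =>
    if src e == v then
      match l with
      | [::] => hN (gen_edge e) (f (tgt e) [::])
      | e' :: l' =>
        if (e' == e) && ~~ inI v then tproj (tgt e) l' (f (tgt e) l') else 0
      end
    else 0
  | gen_ghost e =>
    if tgt e == v then
      tproj (src e) (e :: l) (f (src e) (e :: l)) +
      (if l is [::] then hN (gen_ghost e) (f (src e) [::]) else 0)
    else 0
  end.

Lemma pgenactD x f g : pgenact x (f + g) = pgenact x f + pgenact x g.
Proof.
apply: pfunP => v l; rewrite pfunD.
case: x => [u|e|e] /=; case: eqP => _; rewrite ?addr0 //.
- by rewrite tprojD.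
- case: l => [|e' l]; first by rewrite extD.
  by case: ifP; rewrite ?addr0 ?tprojD.
- rewrite addrACA; congr (_ + _); last by case: l => [|? ?]; rewrite ?extD ?addr0.
  by case: ifP; rewrite ?addr0 ?tprojD.
Qed.

Lemma pgenactZ x k f : pgenact x (pscal k f) = pscal k (pgenact x f).
Proof.
apply: pfunP => v l; rewrite /pscal.
case: x => [u|e|e] /=; case: eqP => _; rewrite ?(scal0 (ksc N)) //.
- by rewrite tprojZ.
- case: l => [|e' l]; first by rewrite extZ.
  by case: ifP; rewrite ?(scal0 (ksc N)) ?tprojZ.
- rewrite scalDr; congr (_ + _).
    by case: ifP; rewrite ?(scal0 (ksc N)) ?tprojZ.
  by case: l => [|? ?]; rewrite ?extZ ?(scal0 (ksc N)).
Qed.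

Lemma tproj_pgenact x f v l : tproj v l (pgenact x f v l) = pgenact x f v l.
Proof.
case: x => [u|e|e] /=; case: eqP => [<-{v}|_]; rewrite ?tproj0 //.
- by rewrite tproj_idem.
- case: l => [|e' l] /=; first by rewrite ext_se.
  have [->|_] := eqVneq e' e; last by rewrite /= tproj0 if_same.
  by rewrite eqxx /=; case: (~~ inI _); rewrite ?tproj_idem.
- rewrite tprojD; congr (_ + _).
    by case: ifP; rewrite ?tproj0 ?tproj_idem.
  by case: l => [|e' l]; rewrite ?tproj0 //= ext_re.
Qed.

Definition pfamily : lfamily E pscaling.
Proof.
exists pgenact.
- exact: pgenactD.
- by move=> x k f; exact: pgenactZ.
- move=> u f; apply: pfunP => v l /=.
  by case: eqP => // _; rewrite tproj_idem.
- move=> u w f uw; apply: pfunP => v l /=; case: eqP => [<-{v}|//].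
  by case: eqP => [wu|_]; [case: uw|exact: tproj0].
- move=> e f; apply: pfunP => v l.
  rewrite {1}/pgenact tproj_pgenact; case: eqP => // /eqP/negPf ev.
  by rewrite /= ev.
- move=> e f; apply: pfunP => v [|e' l] /=; case: eqP => // _.
    by rewrite eqxx ext_er.
  by rewrite eqxx tproj_idem.
- move=> e f; apply: pfunP => v l.
  rewrite {1}/pgenact tproj_pgenact; case: eqP => // /eqP/negPf ev.
  by rewrite /= ev.
- move=> e f; apply: pfunP => v l /=; case: eqP => // _.
  by rewrite !eqxx /= ext_es; case: (~~ inI _); rewrite ?tproj_idem.
(* The relation [e^* e = r(e)]: if [e] starts in the image it also ends there, so only the trivial
   path counts and the relation comes from [N]; otherwise [e] is prepended and stripped again. *)
- move=> e f; apply: pfunP => v l; rewrite /pgenact; case: eqP => // <-{v}.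
  rewrite /= !eqxx /=; have [he|he] /= := boolP (inI (src e)).
    case: l => [|e' l]; first by rewrite add0r ext_ee.
    have /inI_src[e1 <-] := he.
    by rewrite addr0 tgt_emap /= inI_vmap andbF.
  rewrite tproj_idem; case: l => [|e' l]; rewrite ?addr0 //.
  by rewrite ext_gN0 // addr0.
- move=> e e' f ee; apply: pfunP => v l; rewrite /pgenact.
  case: eqP => // _; case: eqP => es.
    have /eqP/negPf ne := ee; rewrite /= ne /= tproj0 if_same add0r.
    by case: l => // *; rewrite ext_ef.
  by rewrite tproj0 add0r; case: l => // *; rewrite ext0.
- move=> w f fw sw; apply: pfunP => v l; rewrite pfun_sum.
  have [wv|wv] := eqVneq w v; last first.
    rewrite /= (negPf wv) big_seq big1 // => e; rewrite in_fset_set //.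
    by move=> /set_mem /= ->; rewrite (negPf wv).
  subst v.
  (* At the trivial path this is (CK2) in [N]; at a path beginning with [e] only the summand of that
     edge can survive. *)
  case: l => [|e l].
    transitivity (\sum_(e <- fset_set (out_edges w))
        hN (gen_edge e) (hN (gen_ghost e) (f w [::]))); last first.
      rewrite !big_seq; apply: eq_bigr => e.
      rewrite in_fset_set // => /set_mem /= ew; rewrite ew !eqxx /=.
      case: (boolP (inI w)) => /= nw; rewrite ?add0r // extD.
      by rewrite !(@ext_eN0 e) ?ew // addr0.
    rewrite /= eqxx; have [[u uw]|nw] := vmapP i w; last first.
      rewrite ext_v0 // big_seq big1 // => e.
      rewrite in_fset_set // => /set_mem /= ew; rewrite ext_e0 // => e' ee.
      by apply: (nw (src e')); rewrite -src_emap ee.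
    subst w; apply: ext_ck2 => // su; apply: sw.
    rewrite /sink -subset0 => e ew; have [e' ee] := out_in ew.
    suff : out_edges u e' by rewrite su.
    by apply: (@vmap_inj _ _ i); rewrite -src_emap ee.
  rewrite /= eqxx; have [ew|ew] /= := eqVneq (src e) w; last first.
    rewrite big_seq big1 // => e'; rewrite in_fset_set // => /set_mem /= e'w.
    rewrite e'w eqxx; case: eqP => //= ee; move: ew.
    by rewrite ee e'w eqxx.
  rewrite (bigD1_seq e) ?fset_uniq ?in_fset_set //=; last exact/mem_set.
  rewrite big_seq_cond big1 ?addr0; last first.
    move=> e' /andP[]; rewrite in_fset_set // => /set_mem /= -> /negPf.
    by rewrite eqxx eq_sym => ->.
  rewrite ew !eqxx /=; case: (boolP (inI w)) => //= nw.
  rewrite !tprojD !tproj_idem; case: l => [|? ?]; rewrite ?tproj0 ?addr0 //.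
  by rewrite ext_gN0 ?ew // tproj0 addr0.
Defined.

Definition path_kmod : kmodule LE := family_kmod pfamily.

Arguments path_kmod : simpl never.

Lemma path_kmodE x f : nact (lgen K x) (f : path_kmod) = pgenact x f.
Proof. exact: family_actE. Qed.

(** Hence functions with a unit satisfy the support condition that [pfun] does not impose. *)
Lemma tproj_act a (f : path_kmod) v l : tproj v l (nact a f v l) = nact a f v l.
Proof.
elim/presented_ind: a f.
- by move=> x f; rewrite [nact _ _]path_kmodE; exact: tproj_pgenact.
- by move=> f; rewrite !nact0l; exact: tproj0.
- move=> a b IHa IHb f; rewrite nactDl [(_ + _ : path_kmod) v l]pfunD tprojD.
  by rewrite IHa IHb.
- move=> a IHa f; rewrite nactNl -[X in tproj _ _ X]sub0r.
  apply: (addrI (nact a f v l)); rewrite -{1}IHa -tprojD subrKC tproj0.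
  by rewrite -[RHS](pfunD (nact a f)) subrr.
- move=> k a IHa f; rewrite kactZl.
  by rewrite [LHS]tprojZ IHa.
- by move=> a b IHa IHb f; rewrite nactA IHa.
Qed.

Lemma tproj_unit (f : path_kmod) v l : has_unit f -> tproj v l (f v l) = f v l.
Proof. by move=> [a fa]; rewrite -fa tproj_act. Qed.

(** The components at the trivial paths are added up; orthogonality of the vertices lets
    [act_ev_fun] recover each one. Finiteness of the vertex set of [G] is used for this sum. *)
Definition ev_fun (f : res path_kmod) : N :=
  \sum_(w <- fset_set [set: vertex G]) nact (lv w) ((f : pfun) (vmap i w) [::]).

Lemma ev_funD (f g : res path_kmod) : ev_fun (f + g) = ev_fun f + ev_fun g.
Proof.
rewrite /ev_fun -big_split; apply: eq_bigr => w _.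
exact: nactDr.
Qed.

Lemma ev_funZ k (f : res path_kmod) : ev_fun (ksc _ k f) = ksc N k (ev_fun f).
Proof.
rewrite /ev_fun (big_morph (ksc N k) (scalDr (ksc N) k) (scal0 (ksc N) k)).
by apply: eq_bigr => w _; rewrite -kactZr.
Qed.

Lemma act_ev_fun u (f : res path_kmod) :
  nact (lv u) (ev_fun f) = nact (lv u) ((f : pfun) (vmap i u) [::]).
Proof.
rewrite /ev_fun nact_sumr (bigD1_seq u) ?fset_uniq ?in_fset_set //=;
  last exact/mem_set.
rewrite big1 ?addr0 ?act_vv // => w /eqP wu.
by rewrite act_vw // => uw; apply: wu.
Qed.

Lemma ev_fun1 u (f : res path_kmod) :
  (forall w, w <> u -> (f : pfun) (vmap i w) [::] = 0) ->
  ev_fun f = nact (lv u) ((f : pfun) (vmap i u) [::]).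
Proof.
move=> f0; rewrite /ev_fun (bigD1_seq u) ?fset_uniq ?in_fset_set //=;
  last exact/mem_set.
by rewrite big1 ?addr0 // => w /eqP /f0 ->; rewrite nact0r.
Qed.

Lemma ev_fung x (f : res path_kmod) :
  ev_fun (nact (lgen K x) f) = nact (lgen K x) (ev_fun f).
Proof.
rewrite [nact _ _]restrictE path_kmodE; case: x => [u|e|e].
- rewrite (@ev_fun1 u) => [|w wu] /=; last first.
    by case: eqP => // /vmap_inj uw; case: wu.
  by rewrite eqxx ext_vmap act_vv [RHS]act_ev_fun.
- rewrite (@ev_fun1 (src e)) => [|w we] /=; last first.
    by rewrite src_emap; case: eqP => // /vmap_inj uw; case: we.
  rewrite src_emap eqxx ext_emap act_se -[RHS]act_er act_ev_fun act_er.
  by rewrite tgt_emap.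
- rewrite (@ev_fun1 (tgt e)) => [|w we] /=; last first.
    by rewrite tgt_emap; case: eqP => // /vmap_inj uw; case: we.
  rewrite tgt_emap eqxx src_emap inI_vmap andbF add0r ext_gemap act_re.
  by rewrite -[RHS]act_es act_ev_fun act_es.
Qed.

Definition ev : khom (res path_kmod) N := leavitt_khom ev_funD ev_funZ ev_fung.

Definition iota_fun (n : N) : res path_kmod :=
  (fun v l => if l is [::] then hN (gen_vertex v) n else 0) : pfun.

Lemma iota_ev (f : res path_kmod) :
  (forall v, tproj v [::] ((f : pfun) v [::]) = (f : pfun) v [::]) ->
  (forall v e l, (f : pfun) v (e :: l) = 0) -> iota_fun (ev f) = f.
Proof.
move=> f1 f0; apply: pfunP => v [|e l]; last by rewrite f0.
rewrite -f1 /=; have [[w <-]|nv] := vmapP i v; last by rewrite !ext_v0.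
by rewrite !ext_vmap; exact: act_ev_fun.
Qed.

Lemma iota_funD m n : iota_fun (m + n) = iota_fun m + iota_fun n.
Proof.
by apply: pfunP => v [|e l]; rewrite pfunD /= ?addr0 // extD.
Qed.

Lemma iota_funZ k n : iota_fun (ksc N k n) = ksc (res path_kmod) k (iota_fun n).
Proof.
apply: pfunP => v [|e l] /=; rewrite /pscal /= ?(scal0 (ksc N)) //.
by rewrite extZ.
Qed.

(** Generators of [G] produce functions supported at vertices of the image, where only trivial paths
    are admissible. *)
Lemma gmap_act_cons y (f : pfun) v e l : pgenact (gmap i y) f v (e :: l) = 0.
Proof.
case: y => [w|e'|e'] /=.
- by have [<-|//] := eqVneq (vmap i w) v; rewrite inI_vmap andbF.
- by have [<-|//] := eqVneq (src (emap i e')) v; rewrite src_emap inI_vmap !andbF.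
- have [_|//] := eqVneq (tgt (emap i e')) v.
  by rewrite src_emap inI_vmap andbF addr0.
Qed.

Lemma iota_fung x n : iota_fun (nact (lgen K x) n) = nact (lgen K x) (iota_fun n).
Proof.
rewrite [RHS]restrictE path_kmodE; apply: pfunP => v [|e l]; last first.
  by rewrite gmap_act_cons.
case: x => [u|e|e] /=; case: eqP => [<-|nv].
- by rewrite !ext_vmap.
- have [[w wv]|nv'] := vmapP i v; last by rewrite ext_v0.
  by rewrite -wv ext_vmap act_vw // => wu; apply: nv; rewrite -wv wu.
- by rewrite src_emap tgt_emap ext_emap !ext_vmap act_se act_er.
- have [[w wv]|nv'] := vmapP i v; last by rewrite ext_v0.
  rewrite -wv ext_vmap -act_se act_vw // => wu; apply: nv.
  by rewrite src_emap -wv wu.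
- rewrite src_emap inI_vmap andbF add0r tgt_emap ext_gemap !ext_vmap.
  by rewrite act_re act_es.
- have [[w wv]|nv'] := vmapP i v; last by rewrite ext_v0.
  rewrite -wv ext_vmap -act_re act_vw // => wu; apply: nv.
  by rewrite tgt_emap -wv wu.
Qed.

Definition iota : khom N (res path_kmod) := leavitt_khom iota_funD iota_funZ
  iota_fung.

(** After a generator of [G] has acted, a function lives on trivial paths, where [ev] determines it;
    the other cases are formal. *)
Lemma res_unit_iota (f : res path_kmod) : has_unit f -> iota (ev f) = f.
Proof.
move=> [b <-]; elim/presented_ind: b f.
- move=> x f; apply: iota_ev => [v|v e l]; rewrite [nact _ _]restrictE path_kmodE.
    exact: tproj_pgenact.
  exact: gmap_act_cons.
- by move=> f; rewrite nact0l !khom0.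
- by move=> a b IHa IHb f; rewrite nactDl !khomD IHa IHb.
- by move=> a IHa f; rewrite nactNl !khomN IHa.
- by move=> k a IHa f; rewrite kactZl !khomZ IHa.
- by move=> a b IHa IHb f; rewrite nactA IHa.
Qed.

End Paths.

(** Every generator factors on the right through a vertex, so an element killed by all vertices is
    killed by the whole algebra, including its own unit. *)
Lemma vertices_faithful (F : graph) (M : kmodule (leavitt K F)) (m : M) :
  has_unit m -> (forall v, nact (lv v) m = 0) -> m = 0.
Proof.
move=> [a am] m0; rewrite -am; elim/leavitt_ind: a {am} => //.
- by move=> e; rewrite -act_er m0 nact0r.
- by move=> e; rewrite -act_es m0 nact0r.
- exact: nact0l.
- by move=> a b am bm; rewrite nactDl am bm addr0.
- by move=> a am; rewrite nactNl am oppr0.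
- by move=> k a am; rewrite kactZl am scal0.
- by move=> a b _ bm; rewrite nactA bm nact0r.
Qed.

(** The two sides agree after applying each vertex, and the unit of [n] makes this enough. Together
    with [res_unit_iota] this identifies a unital [N] with the unital part of the restricted path
    module. *)
Lemma ev_iota (N : kmodule LG) (n : N) : has_unit n -> ev N (iota N n) = n.
Proof.
move=> un; apply/eqP; rewrite -subr_eq0; apply/eqP;
  apply: vertices_faithful => [|v].
  apply: (has_unitD lu) (has_unitN un); apply: khom_has_unit.
  exact: khom_has_unit.
have e : nact (lv v) (ev N (iota N n)) = nact (lv v) n.
  by rewrite [LHS]act_ev_fun /= ext_vmap act_vv.
by rewrite nactDr nactNr e subrr.
Qed.

Section PathMap.
Variables (N N' : kmodule LG) (g : khom N N').

Lemma ext_khom x n : g (ext i x n) = ext i x (g n).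
Proof. by rewrite /ext; case: pselect => *; rewrite ?khomA ?khom0. Qed.

Lemma tproj_khom v l n : g (tproj v l n) = tproj v l (g n).
Proof.
elim: l v => [|e l IH] v /=; first exact: ext_khom.
by case: ifP; rewrite ?khom0.
Qed.

Definition path_map_fun (f : path_kmod N) : path_kmod N' :=
  (fun v l => g ((f : pfun N) v l)) : pfun N'.

Lemma path_map_funD f f' : path_map_fun (f + f') = path_map_fun f + path_map_fun f'.
Proof. by apply: pfunP => v l; exact: khomD. Qed.

Lemma path_map_funZ k f :
  path_map_fun (ksc (path_kmod N) k f) = ksc (path_kmod N') k (path_map_fun f).
Proof. by apply: pfunP => v l; exact: khomZ. Qed.

Lemma path_map_fung x f :
  path_map_fun (nact (lgen K x) f) = nact (lgen K x) (path_map_fun f).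
Proof.
rewrite !path_kmodE; apply: pfunP => v l; rewrite /path_map_fun.
case: x => [u|e|e] /=; case: eqP; rewrite ?khom0 // => _.
- exact: tproj_khom.
- case: l => [|e' l]; first exact: ext_khom.
  by case: ifP; rewrite ?khom0 ?tproj_khom.
- rewrite khomD; congr (_ + _); first by case: ifP; rewrite ?khom0 ?tproj_khom.
  by case: l => *; rewrite ?khom0 ?ext_khom.
Qed.

Definition path_map : khom (path_kmod N) (path_kmod N') :=
  leavitt_khom path_map_funD path_map_funZ path_map_fung.

Lemma path_map_iota n : path_map (iota N n) = iota N' (g n).
Proof. by apply: pfunP => v [|e l]; [exact: ext_khom|exact: khom0]. Qed.

Lemma ev_path_map f : ev N' (path_map f) = g (ev N f).
Proof.
rewrite /= /ev_fun (big_morph g (khomD g) (khom0 g)).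
by apply: eq_bigr => w _; rewrite khomA.
Qed.

End PathMap.

Lemma res_has_unit (M : kmodule LE) (m : M) :
  has_unit (m : res M) -> has_unit m.
Proof.
by move=> [b mb]; have [a ab] := restrict_act (@full_ck_restricts M) b; exists a;
  rewrite -ab.
Qed.

(** * The unit of (j, r) *)

Section Descend.
Variables (M : kmodule LE) (J : kmodule LG) (jval : khom J (res M)).
Hypothesis jval_inj : injective jval.
Hypothesis jval_surj : forall m : res M, has_unit m -> exists x, jval x = m.
Hypothesis J_unit : forall x : J, has_unit x.

Lemma jval_gen y (x : J) :
  jval (nact (lgen K y) x) = nact (lgen K (gmap i y)) (jval x : M) :> M.
Proof. by rewrite khomA [LHS]restrictE. Qed.

Lemma jvertexP v (m : M) :
  exists x, jval x = if inI v then nact (lv v) m else 0.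
Proof.
apply: jval_surj; case: (boolP (inI v)) => [/asboolP[w <-]|_];
  last exact: has_unit0.
by exists (lv w); rewrite [LHS]restrictE [LHS]act_vv.
Qed.

Definition jvertex v (m : M) : J := projT1 (cid (jvertexP v m)).

Lemma jvalE v m : jval (jvertex v m) = if inI v then nact (lv v) m else 0.
Proof. by rewrite /jvertex; case: cid. Qed.

Lemma jvertexD v m n : jvertex v (m + n) = jvertex v m + jvertex v n.
Proof.
apply: jval_inj; rewrite khomD !jvalE.
by case: ifP => _; [exact: (@nactDr LE M) | exact: (esym (addr0 (0 : M)))].
Qed.

Lemma jvertexZ v k m : jvertex v (ksc M k m) = ksc J k (jvertex v m).
Proof.
apply: jval_inj; rewrite khomZ !jvalE.
case: ifP => _; first exact: (@kactZr K LE M).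
exact: (esym (scal0 (ksc M) k)).
Qed.

Local Notation hj := (ext i (M := J)).

Lemma jvertex_v u v m :
  jvertex v (nact (lv u) m) = if u == v then jvertex v m else 0.
Proof.
apply: jval_inj; case: eqP => [->|uv]; rewrite !jvalE ?act_vv //.
rewrite khom0; case: ifP => // _.
by rewrite act_vw // => vu; apply: uv.
Qed.

Lemma hj_vertex v m : hj (gen_vertex v) (jvertex v m) = jvertex v m.
Proof.
apply: jval_inj; have [[w <-]|nv] := vmapP i v.
  by rewrite ext_vmap jval_gen jvalE inI_vmap act_vv.
rewrite ext_v0 // khom0 jvalE.
by case: ifP => // /asboolP[w wv]; case: (nv w).
Qed.

Lemma hj_edge e m : hj (gen_edge e) (jvertex (tgt e) m) = jvertex (src e) (nact
  (le e) m).
Proof.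
apply: jval_inj; rewrite !jvalE act_se; case: (boolP (inI _)) =>
  [/inI_src[e' <-]|ne].
  by rewrite ext_emap jval_gen jvalE tgt_emap inI_vmap /= -tgt_emap act_er.
by rewrite ext_eN0 // khom0.
Qed.

Lemma hj_ghost e m : hj (gen_ghost e) (jvertex (src e) m) =
  if inI (src e) then jvertex (tgt e) (nact (lg e) m) else 0.
Proof.
case: (boolP (inI _)) => [/inI_src[e' <-]|ne]; last by rewrite ext_gN0.
apply: jval_inj; rewrite ext_gemap jval_gen !jvalE src_emap tgt_emap !inI_vmap.
by rewrite /= -src_emap -tgt_emap act_es act_re.
Qed.

(** This is [l^* m] as an element of [J], for a path [l] from [v] that meets the image only at its
    end point; as in [tproj], the value is 0 if [l] is not such a path. *)
Fixpoint down v (l : seq (edge E)) (m : M) : J :=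
  match l with
  | [::] => jvertex v m
  | e :: l' => if (src e == v) && ~~ inI v then down (tgt e) l' (nact (lg e) m)
    else 0
  end.

Lemma down_cons v e l m : down v (e :: l) m =
  if (src e == v) && ~~ inI v then down (tgt e) l (nact (lg e) m) else 0.
Proof. by []. Qed.

Lemma downD v l m n : down v l (m + n) = down v l m + down v l n.
Proof.
elim: l v m n => [|e l IH] v m n /=; first exact: jvertexD.
by case: ifP => _; rewrite ?addr0 // [nact _ _]nactDr IH.
Qed.

Lemma down0 v l : down v l 0 = 0.
Proof. by apply: (addrI (down v l 0)); rewrite -downD !addr0. Qed.

Lemma downZ v l k m : down v l (ksc M k m) = ksc J k (down v l m).
Proof.
elim: l v m => [|e l IH] v m /=; first exact: jvertexZ.
case: ifP => _; last by rewrite [RHS](scal0 (ksc J)).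
by rewrite -IH; congr (down _ _ _); exact: kactZr.
Qed.

Lemma tproj_down v l m : tproj v l (down v l m) = down v l m.
Proof.
elim: l v m => [|e l IH] v m; first exact: hj_vertex.
rewrite [down _ _ _]/=.
have [c|/negPf c] := boolP ((src e == v) && ~~ inI v).
  by rewrite [LHS]/= c; exact: IH.
exact: tproj0.
Qed.

Lemma down_v u v l m : down v l (nact (lv u) m) = if u == v then down v l m else 0.
Proof.
case: l => [|e l] /=; first exact: jvertex_v.
have [ev|ev] /= := eqVneq (src e) v; last by rewrite if_same.
case: (~~ inI v); last by rewrite if_same.
have [->|/eqP uv] := eqVneq u v; first by rewrite -ev [nact _ (nact _ _)]act_es.
rewrite [nact _ _](_ : _ = 0) ?down0 // -[LHS]act_es act_vw ?nact0r //.
by move=> su; apply: uv; rewrite -su.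
Qed.

Definition rho_fun (m : M) : path_kmod J :=
  (fun v l => down v l m) : pfun J.

Lemma rho_funD m n : rho_fun (m + n) = rho_fun m + rho_fun n.
Proof. by apply: pfunP => v l; exact: downD. Qed.

Lemma rho_funZ k m :
  rho_fun (ksc M k m) = ksc (path_kmod J) k (rho_fun m).
Proof. by apply: pfunP => v l; exact: downZ. Qed.

Lemma rho_fung x m : rho_fun (nact (lgen K x) m) = nact (lgen K x) (rho_fun m).
Proof.
rewrite [RHS]path_kmodE; apply: pfunP => v l; rewrite /rho_fun.
case: x => [u|e|e] /=.
- by rewrite [LHS]down_v tproj_down.
- case: l => [|e' l] /=.
    by rewrite -[nact _ m]act_se [LHS]jvertex_v hj_edge; case: eqP => // <-.
  have [->|/eqP ee] := eqVneq e' e.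
    case: eqP => //= <-; case: (~~ inI _) => //.
    by rewrite [nact (lg _) _]act_ee [LHS]down_v eqxx tproj_down.
  rewrite if_same; case: ifP => // _.
  by rewrite [nact (lg _) _]act_ef ?down0.
(* If [e] starts outside the image, prepending it to [l] is the recursion step of [down]; if it
   starts inside, it ends inside, so both sides vanish unless [l] is trivial. *)
- have [<-{v}|tv] := eqVneq (tgt e) v; last first.
    by rewrite -[nact _ m]act_re [LHS]down_v (negPf tv).
  rewrite eqxx /=; case: (boolP (inI (src e))) => /= es; last first.
    rewrite tproj_down; case: l => [|? ?]; rewrite ?addr0 //.
    by rewrite hj_ghost (negPf es) addr0.
  rewrite add0r; case: l => [|e' l] /=; first by rewrite hj_ghost es.
  by have /inI_src[e1 <-] := es; rewrite tgt_emap inI_vmap andbF.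
Qed.

Definition rho : khom M (path_kmod J) :=
  @leavitt_khom K E M (path_kmod J) rho_fun
    rho_funD rho_funZ rho_fung.

(** An element of [J] has the form [b x] with [b] in L(G), and each generator of [G] factors on the
    left through a vertex of the image, which is orthogonal to [v]. *)
Lemma jval_notin v (x : J) : ~~ inI v -> nact (lv v) (jval x) = 0.
Proof.
move=> nv; have [b xb] := J_unit x.
rewrite -xb khomA; elim/leavitt_ind: b (jval x) {xb} => {x}.
- move=> w m; rewrite [nact (lv w) _](restrictE _ (gen_vertex w)) act_vw //.
  by move=> vw; move: nv; rewrite vw inI_vmap.
- move=> e m; rewrite [nact (le e) _](restrictE _ (gen_edge e)) -act_se act_vw //.
  by move=> vw; move: nv; rewrite vw src_emap inI_vmap.
- move=> e m; rewrite [nact (lg e) _](restrictE _ (gen_ghost e)) -act_re act_vw //.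
  by move=> vw; move: nv; rewrite vw tgt_emap inI_vmap.
- by move=> m; rewrite nact0l nact0r.
- by move=> a b IHa IHb m; rewrite nactDl nactDr IHa IHb addr0.
- by move=> a IHa m; rewrite nactNl nactNr IHa oppr0.
- move=> k a IHa m; rewrite (@kactZl K LG (res M)) [LHS](@kactZr K LE M).
  by rewrite IHa scal0.
- by move=> a b IHa IHb m; rewrite nactA IHa.
Qed.

(** A nontrivial path starts outside the image, at a vertex that kills the image of [J]; only
    trivial paths contribute. *)
Lemma rho_jval (x : J) : rho (jval x) = iota J x.
Proof.
apply: pfunP => v [|e l] /=.
  apply: jval_inj; rewrite jvalE; have [[w <-]|nv] := vmapP i v.
    by rewrite inI_vmap ext_vmap jval_gen.
  rewrite ext_v0 // khom0; case: ifP => // /asboolP[w wv]; by case: (nv w).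
case: ifP => // /andP[/eqP ev nv].
by rewrite -[nact _ _]act_es ev jval_notin // nact0r; exact: down0.
Qed.

End Descend.

Section DownHom.
Variables (M M' : kmodule LE) (J J' : kmodule LG).
Variables (jval : khom J (res M)) (jval' : khom J' (res M')).
Hypothesis jval_surj : forall m : res M, has_unit m -> exists x, jval x = m.
Hypothesis jval_surj' : forall m : res M', has_unit m -> exists x, jval' x = m.
Hypothesis jval_inj' : injective jval'.
Variables (f : khom M M') (fj : khom J J').
Hypothesis fjE : forall x, jval' (fj x) = f (jval x).

Lemma down_khom v l m : fj (down jval_surj v l m) = down jval_surj' v l (f m).
Proof.
elim: l v m => [|e l IH] v m /=.
  apply: jval_inj'; rewrite fjE !jvalE.
  by case: ifP; rewrite ?khom0 ?khomA.
by case: ifP => _; rewrite ?khom0 // -khomA IH.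
Qed.

End DownHom.

Definition jv (M : umodule LE) : khom (k_of (jM M)) (res (k_of M)) :=
  upart_val lu _.

Lemma jv_inj (M : umodule LE) : injective (jv M).
Proof. exact: val_inj. Qed.

Lemma jv_surj (M : umodule LE) (m : res (k_of M)) : has_unit m -> exists x, jv
  M x = m.
Proof. by move=> um; exists (in_sub (um : unit_part lu (res (k_of M)) m)). Qed.

Lemma jv_unit (M : umodule LE) (x : k_of (jM M)) : has_unit x.
Proof. exact: (umod_has_unit lu (x : jM M)). Qed.

Lemma jv_fmap (M M' : umodule LE) (f : umod_hom M M') (x : jM M) :
  jv M' (fmap functor_j f x) = f (jv M x).
Proof. by []. Qed.

Local Notation downM M := (down (@jv_surj M)).
Local Notation rhoM M := (rho (@jv_inj M) (@jv_surj M)).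

Lemma down_umod_hom (M M' : umodule LE) (f : umod_hom M M') v l m :
  fmap functor_j f (downM M v l m) = downM M' v l (f m).
Proof.
exact: (@down_khom (k_of M) (k_of M') _ _ _ _ (@jv_surj M) (@jv_surj M')
  (@jv_inj M')
  (khom_of lu f) (khom_of lu (fmap functor_j f))).
Qed.

(** * Unital submodules of the path module that contain the functions on trivial paths *)

Section PathSubmodule.
Variables (N : umodule LG) (S : submod (path_kmod (k_of N))).
Hypothesis S_unit : forall f, S f -> has_unit f.
Hypothesis S_iota : forall n, S (iota (k_of N) n).

(** Both r(N) and s(N) are of this kind, so [evS] and [iotaS] show for both at once that applying j
    gives back [N]. *)
Definition path_umod : umodule LE := sub_umod S_unit.

Definition pval : khom (k_of path_umod) (path_kmod (k_of N)) :=
  sub_val_khom lu S_unit.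

Definition evS : umod_hom (jM path_umod) N :=
  @umod_hom_of K LG lu (jM path_umod) N
    (khom_comp (ev (k_of N)) (khom_comp (res_hom pval) (jv path_umod))).

Lemma evSE x : evS x = ev (k_of N) (pval (jv _ x)).
Proof. by []. Qed.

Definition iotaS_fun (n : k_of N) : res (k_of path_umod) := in_sub (S_iota n).

Lemma pval_inj : injective pval.
Proof. exact: val_inj. Qed.

Lemma iotaS_funD m n : iotaS_fun (m + n) = iotaS_fun m + iotaS_fun n.
Proof.
apply: pval_inj; rewrite [RHS](khomD (res_hom pval)).
exact: (khomD (iota (k_of N))).
Qed.

Lemma iotaS_funZ k n : iotaS_fun (ksc (k_of N) k n) = ksc (res (k_of
  path_umod)) k (iotaS_fun n).
Proof.
apply: pval_inj; rewrite [RHS](khomZ (res_hom pval)).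
exact: (khomZ (iota (k_of N))).
Qed.

Lemma iotaS_fung x n :
  iotaS_fun (nact (lgen K x) n) = nact (lgen K x) (iotaS_fun n).
Proof.
apply: pval_inj; rewrite [RHS](khomA (res_hom pval)).
exact: (khomA (iota (k_of N))).
Qed.

Definition iotaS : umod_hom N (jM path_umod) :=
  @upart_lift K LG lu N _ (leavitt_khom iotaS_funD iotaS_funZ iotaS_fung).

Lemma iotaSE n : pval (jv _ (iotaS n)) = iota (k_of N) n.
Proof. by []. Qed.

Lemma iotaSK n : evS (iotaS n) = n.
Proof. by rewrite evSE iotaSE ev_iota //; exact: (umod_has_unit lu n). Qed.

Lemma evSK x : iotaS (evS x) = x.
Proof.
apply: jv_inj; apply: pval_inj; rewrite [LHS]iotaSE evSE.
apply: res_unit_iota; have [b xb] := jv_unit x.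
exists b; rewrite -[LHS](khomA (res_hom pval)); congr (pval _).
by rewrite -[LHS](khomA (jv path_umod)) xb.
Qed.

(** Triangle identity for (j, r): the value of [F] at [l] is that of [l^* F] at a trivial path. The
    induction turns the edges of the path one by one into ghosts acting on [F]. *)
Lemma evS_down v l (F : path_umod) :
  evS (downM path_umod v l F) = (pval F : pfun (k_of N)) v l.
Proof.
rewrite -[RHS]tproj_unit; last first.
  exact: (@khom_has_unit K LE (k_of path_umod) _ pval F (umod_has_unit lu F)).
elim: l v F => [|e l IH] v F.
  rewrite [down _ _ _ _]/= evSE jvalE [RHS]/=.
  case: ifP => [/asboolP[w <-]|/negbT nv]; last first.
    by rewrite ext_vN0 // !khom0.
  rewrite ext_vmap -[RHS](act_ev_fun (N := k_of N)) -[RHS](khomA (ev (k_of N))).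
  by rewrite restrictE [pval _]khomA.
have pe : pval (nact (lg e) (F : k_of path_umod)) = pgenact (gen_ghost e) (pval F).
  by rewrite (khomA pval); exact: path_kmodE.
rewrite down_cons tproj_cons.
have [/andP[/eqP ev nv]|_] := boolP ((src e == v) && ~~ inI v).
  rewrite IH pe tproj_pgenact /pgenact eqxx tproj_cons ev eqxx nv.
  by case: l {IH} => [|? ?]; rewrite ?addr0 // ext_gN0 ?ev // addr0.
exact: (umod_hom0 evS).
Qed.

End PathSubmodule.

(** * The right adjoint r of j *)

Section Coinduction.
Implicit Types N : umodule LG.

Definition r_obj N : umodule LE := upart lu (path_kmod (k_of N)).

Lemma iota_unit N n : unit_part lu (path_kmod (k_of N)) (iota (k_of N) n).
Proof.
apply: res_has_unit; apply: khom_has_unit; exact: (umod_has_unit lu (n : N)).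
Qed.

Definition functor_r : functor (Mod LG) (Mod LE).
Proof.
exists (r_obj : Mod LG -> Mod LE) (fun N N' f =>
  upart_map lu (path_map (khom_of lu f))).
- by move=> N; apply: umod_hom_eq => x; apply: val_inj.
- by move=> N N' N'' g f; apply: umod_hom_eq => x; apply: val_inj.
Defined.

Local Notation ev_r N := (@evS N (unit_part lu (path_kmod (k_of N))) (fun _ => id)).
Local Notation iota_r N := (@iotaS N (unit_part lu (path_kmod (k_of N))) (fun _
  => id) (@iota_unit N)).
Local Notation pval_r N := (@pval N (unit_part lu (path_kmod (k_of N))) (fun _
  => id)).

Definition r_lift (M : umodule LE) N (g : umod_hom (jM M) N) : umod_hom M
  (r_obj N) :=
  @upart_lift K LE lu M _ (khom_comp (path_map (khom_of lu g)) (rhoM M)).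

Lemma r_liftE (M : umodule LE) N (g : umod_hom (jM M) N) m v l :
  (pval_r N (r_lift g m) : pfun (k_of N)) v l = g (downM M v l m).
Proof. by []. Qed.

Lemma ev_r_lift (M : umodule LE) N (g : umod_hom (jM M) N) x :
  ev_r N (fmap functor_j (r_lift g) x) = g x.
Proof.
rewrite evSE jv_fmap.
have -> : pval_r N (r_lift g (jv M x)) = iota (k_of N) (g x); last first.
  exact: (@ev_iota (k_of N) (g x) (umod_has_unit lu (g x))).
transitivity (path_map (khom_of lu g) (rhoM M (jv M x))); first by [].
rewrite (rho_jval (@jv_inj M) (@jv_surj M) (@jv_unit M)).
exact: (path_map_iota (khom_of lu g) x).
Qed.

Lemma r_lift_ev (M : umodule LE) N (h : umod_hom M (r_obj N)) :
  r_lift (umod_comp (ev_r N) (fmap functor_j h)) = h.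
Proof.
apply: umod_hom_eq => m; apply: (@pval_inj N (unit_part lu _) (fun _ => id)).
apply: pfunP => v l; rewrite [LHS]r_liftE -evS_down.
exact: (congr1 (ev_r N) (down_umod_hom h v l m)).
Qed.

Lemma adj_jr : left_adjoint functor_j functor_r.
Proof.
exists r_lift; split=> [M N|M M' N N' a b f].
  exists (fun h => umod_comp (ev_r N) (fmap functor_j h)) => [g|h].
    by apply: umod_hom_eq => x; exact: ev_r_lift.
  exact: r_lift_ev.
apply: umod_hom_eq => m; apply: (@pval_inj N' (unit_part lu _) (fun _ => id)).
apply: pfunP => v l.
exact: (congr1 (fun x => b (f x)) (down_umod_hom a v l m)).
Qed.

Lemma ev_r_fmap N N' (f : umod_hom N N') x :
  ev_r N' (fmap functor_j (fmap functor_r f) x) = f (ev_r N x).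
Proof. exact: (ev_path_map (khom_of lu f) (pval_r N (jv _ x))). Qed.

(** [ev_r] is natural and has the inverse [iota_r], so the preimage of [h] must be its conjugate by
    them. That this works is checked on adjuncts, which determine a map into r(N'). *)
Lemma functor_r_ff : fully_faithful functor_r.
Proof.
move=> N N'; apply: inj_surj_bij => [f g fg|h].
  apply: umod_hom_eq => n.
  have := ev_r_fmap f (iota_r N n); have := ev_r_fmap g (iota_r N n).
  by rewrite iotaSK fg => -> ->.
pose f := umod_comp (ev_r N') (umod_comp (fmap functor_j h) (iota_r N)).
exists f; rewrite -[LHS]r_lift_ev -[RHS]r_lift_ev; congr r_lift.
apply: umod_hom_eq => x; rewrite [LHS](ev_r_fmap f) /f.
exact: (congr1 (fun x => ev_r N' (fmap functor_j h x)) (@evSK N _ _ (@iota_unit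
  N) x)).
Qed.

End Coinduction.

(** * The left adjoint s of j *)

Section Induction.
Implicit Types N : umodule LG.

Definition s_sub N : submod (path_kmod (k_of N)) :=
  generated (fun f : path_kmod (k_of N) => exists n, f = iota (k_of N) n).

Lemma s_sub_unit N f : s_sub N f -> has_unit f.
Proof.
apply: (_ : _ -> unit_part lu (path_kmod (k_of N)) f).
by apply=> _ [n ->]; exact: iota_unit.
Qed.

Lemma s_sub_iota N n : s_sub N (iota (k_of N) n).
Proof. by apply: generated_sub; exists n. Qed.

Definition s_obj N : umodule LE := path_umod (@s_sub_unit N).

Local Notation ev_s N := (evS (@s_sub_unit N)).
Local Notation iota_s N := (iotaS (@s_sub_unit N) (@s_sub_iota N)).
Local Notation pval_s N := (pval (@s_sub_unit N)).

Lemma s_map_sub N N' (f : umod_hom N N') x :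
  s_sub N' (path_map (khom_of lu f) (pval_s N x)).
Proof.
have := sub_valP x; rewrite -[val x]/(pval_s N x).
apply: (_ : _ -> kpreim (path_map (khom_of lu f)) (s_sub N') (pval_s N x)).
apply=> _ [n ->].
exact: (eq_ind_r (s_sub N') (@s_sub_iota N' (f n)) (path_map_iota (khom_of lu
  f) n)).
Qed.

Definition s_map N N' (f : umod_hom N N') : umod_hom (s_obj N) (s_obj N') :=
  @sub_lift K LE lu _ (s_sub N') (@s_sub_unit N') (s_obj N)
    (khom_comp (path_map (khom_of lu f)) (pval_s N)) (s_map_sub f).

Definition functor_s : functor (Mod LG) (Mod LE).
Proof.
exists (s_obj : Mod LG -> Mod LE) s_map.
- by move=> N; apply: umod_hom_eq => x; apply: val_inj.
- by move=> N N' N'' g f; apply: umod_hom_eq => x; apply: val_inj.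
Defined.

(** The equalizer of [h] and [h'], transported into the path module where the generators live, is a
    submodule containing every [iota n]. *)
Lemma s_ext N (M : umodule LE) (h h' : umod_hom (s_obj N) M) :
  (forall n, h (jv _ (iota_s N n)) = h' (jv _ (iota_s N n))) -> h = h'.
Proof.
move=> hh; apply: umod_hom_eq => x.
pose T := kimage (pval_s N) (kequalizer (khom_of lu h) (khom_of lu h')).
suff [y [hy /pval_inj <-]] : T (pval_s N x) by [].
apply: (sub_valP x) => _ [n ->].
by exists (jv _ (iota_s N n)); split; [exact: hh|].
Qed.

Lemma s_map_iota N N' (f : umod_hom N N') n :
  s_map f (jv _ (iota_s N n)) = jv _ (iota_s N' (f n)).
Proof. apply: pval_inj; exact: (path_map_iota (khom_of lu f) n). Qed.

Section Lift.
Variables (M : kmodule LE) (M_unit : forall m : M, has_unit m).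

(* The elements of the submodule generated by [j(M)] satisfy [dep n] for some
   [n], and relation (CK2) allows inductions on [n]. *)
Fixpoint dep (n : nat) (m : M) : Prop :=
  match n with
  | 0 => forall v, ~~ inI v -> nact (lv v) m = 0
  | n.+1 => (forall v, ~~ inI v -> sink v -> nact (lv v) m = 0) /\
            (forall e, ~~ inI (src e) -> dep n (nact (lg e) m))
  end.

Lemma dep0 n : dep n 0.
Proof.
elim: n => [|n IH] /=; first by move=> v _; rewrite nact0r.
by split=> [v _ _|e _]; rewrite [nact _ _]nact0r.
Qed.

Lemma depD n m m' : dep n m -> dep n m' -> dep n (m + m').
Proof.
elim: n m m' => [|n IH] m m' /=.
  by move=> hm hm' v nv; rewrite nactDr hm // hm' // addr0.
move=> [sm dm] [sm' dm']; split=> [v nv sv|e ne].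
  by rewrite nactDr sm // sm' // addr0.
by rewrite nactDr; apply: IH; [exact: dm|exact: dm'].
Qed.

Lemma depN n m : dep n m -> dep n (- m).
Proof.
elim: n m => [|n IH] m /=.
  by move=> hm v nv; rewrite nactNr hm // oppr0.
move=> [sm dm]; split=> [v nv sv|e ne].
  by rewrite nactNr sm // oppr0.
by rewrite [nact _ _]nactNr; apply: IH; exact: dm.
Qed.

Lemma depZ n k m : dep n m -> dep n (ksc M k m).
Proof.
have k0 := scal0 (ksc M) k.
elim: n m => [|n IH] m /=.
  by move=> hm v nv; rewrite kactZr hm.
move=> [sm dm]; split=> [v nv sv|e ne].
  by rewrite kactZr sm.
by rewrite kactZr; apply: IH; exact: dm.
Qed.

Lemma depS n m : dep n m -> dep n.+1 m.
Proof.
elim: n m => [|n IH] m; last first.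
  by move=> [sm dm]; split=> // e ne; apply: IH; exact: dm.
move=> hm; split=> [v nv _|e ne v nv]; first exact: hm.
by rewrite -(act_es (M := M) e m) hm // !nact0r.
Qed.

Lemma dep_leq n p m : (n <= p)%N -> dep n m -> dep p m.
Proof.
move=> /subnK <- dm; elim: (p - n)%N => [|q IH] //.
by rewrite addSn; exact: depS.
Qed.

Lemma dep_vertex n u m : dep n m -> dep n (nact (lv u) m).
Proof.
have vu v : nact (lv v) (nact (lv u) m) = if v == u then nact (lv v) m else 0.
  by case: eqP => [->|vu]; rewrite ?act_vv ?act_vw.
case: n => [|n] /=.
  by move=> hm v nv; rewrite [LHS]vu; case: eqP => // _; exact: hm.
move=> [sm dm]; split=> [v nv sv|e ne].
  by rewrite [LHS]vu; case: eqP => // _; exact: sm.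
have [<-|/eqP eu] := eqVneq (src e) u; first by rewrite [nact _ _]act_es; exact: dm.
by rewrite -[nact _ _]act_es [nact (lv (src e)) _]act_vw // [nact _ _]nact0r;
  exact: dep0.
Qed.

(** [f^* e] is [r(e)] or 0, so applying [e] costs one level; and the source of [e] is not a sink. *)
Lemma dep_edge n e m : dep n m -> dep n.+1 (nact (le e) m).
Proof.
move=> dm; split=> [v nv sv|f nf].
  rewrite -[nact (le e) m]act_se [LHS]act_vw // => ve.
  by have : out_edges v e by []; rewrite sv.
have [->|/eqP fe] := eqVneq f e.
  by rewrite [nact _ _]act_ee; exact: dep_vertex.
by rewrite [nact _ _]act_ef //; exact: dep0.
Qed.

Lemma dep_ghost n e m : dep n m -> dep n (nact (lg e) m).
Proof.
move=> dm; have [he|ne] := boolP (inI (src e)).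
  apply: (@dep_leq 0) => // v nv; rewrite -[nact _ m]act_re [LHS]act_vw //.
  move=> vt; move: nv; rewrite vt; have /inI_src[e' <-] := he.
  by rewrite tgt_emap inI_vmap.
by have [_] := depS dm; exact.
Qed.

Lemma dep_act a n m : dep n m -> exists p, dep p (nact a m).
Proof.
elim/leavitt_ind: a n m.
- by move=> v n m dm; exists n; exact: dep_vertex.
- by move=> e n m dm; exists n.+1; exact: dep_edge.
- by move=> e n m dm; exists n; exact: dep_ghost.
- by move=> n m _; exists 0%N; rewrite [nact _ _]nact0l; exact: dep0.
- move=> a b IHa IHb n m dm.
  have [[p dp] [q dq]] := (IHa n m dm, IHb n m dm).
  exists (maxn p q); rewrite nactDl; apply: depD.
    exact: dep_leq (leq_maxl _ _) dp.
  exact: dep_leq (leq_maxr _ _) dq.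
- move=> a IHa n m dm; have [p dp] := IHa n m dm; exists p.
  by rewrite [nact _ _]nactNl; exact: depN.
- move=> k a IHa n m dm; have [p dp] := IHa n m dm; exists p.
  by rewrite kactZl; exact: depZ.
- move=> a b IHa IHb n m dm; have [p dp] := IHb n m dm.
  by rewrite nactA; exact: IHa dp.
Qed.

Definition dep_submod : submod M.
Proof.
exists (fun m => exists n, dep n m).
- by exists 0%N; exact: dep0.
- move=> m m' [n dn] [p dp]; exists (maxn n p); apply: depD.
    exact: dep_leq (leq_maxl _ _) dn.
  exact: dep_leq (leq_maxr _ _) dp.
- by move=> m [n dn]; exists n; exact: depN.
- by move=> a m [n dn]; exact: dep_act dn.
Defined.

Variables (J : kmodule LG) (jval : khom J (res M)).
Hypothesis jval_inj : injective jval.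
Hypothesis jval_surj : forall m : res M, has_unit m -> exists x, jval x = m.
Hypothesis J_unit : forall x : J, has_unit x.

Lemma rho_eq0 v m : rho jval_inj jval_surj m = 0 -> jvertex jval_surj v m = 0.
Proof. by move=> /(congr1 (fun f : pfun J => f v [::])). Qed.

(** It suffices that every vertex kills [m]. For a vertex in the image, [v m] is the value of
    [rho m] at a trivial path; outside, sinks kill [m] by assumption, and at any other vertex (CK2)
    reduces the claim to the elements [e^* m], of smaller depth and still killed by [rho]. *)
Lemma dep_rho_inj n m : dep n m -> rho jval_inj jval_surj m = 0 -> m = 0.
Proof.
elim: n m => [|n IH] m dm rm; apply: vertices_faithful => // v.
  have [iv|nv] := boolP (inI v); last exact: dm.
  by have := jvalE jval_surj v m; rewrite iv => <-; rewrite rho_eq0 ?khom0.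
have [iv|nv] := boolP (inI v).
  by have := jvalE jval_surj v m; rewrite iv => <-; rewrite rho_eq0 ?khom0.
have [sm dgm] := dm; have [sv|nsv] := pselect (sink v); first exact: sm.
rewrite act_ck2 // big_seq big1 // => e; rewrite in_fset_set // => /set_mem /= ev.
rewrite [nact (lg e) m]IH ?nact0r //; first by apply: dgm; rewrite ev.
by rewrite khomA rm nact0r.
Qed.

Definition j_gen : submod M := generated (fun m : M => exists x, m = jval x).

(** By [jval_notin] the generators have depth 0, and the elements of finite depth form a submodule;
    so [dep_rho_inj] applies to the difference. *)
Lemma j_gen_rho_inj m m' : j_gen m -> j_gen m' ->
  rho jval_inj jval_surj m = rho jval_inj jval_surj m' -> m = m'.
Proof.
have genD x : j_gen x -> dep_submod x.
  by apply=> _ [y ->]; exists 0%N => v nv; exact: (jval_notin jval J_unit y nv).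
move=> gm gm' e; apply/eqP; rewrite -subr_eq0; apply/eqP.
have [n dn] := genD _ (smemD gm (smemN gm')).
by apply: dep_rho_inj dn _; rewrite khomD khomN e subrr.
Qed.

End Lift.

Section SLift.
Variables (N : umodule LG) (M : umodule LE) (g : umod_hom N (jM M)).
Local Notation T := (j_gen (jv M)).

(** The functions that [path_map] sends into the image of [T] under [rho] form a submodule; for a
    generator [iota n], the element [g n] is a preimage by [rho_jval]. *)
Lemma s_lift_ex (x : s_obj N) : exists m, T m /\
  rhoM M m = path_map (khom_of lu g) (pval_s N x).
Proof.
have := sub_valP x; rewrite -[val x]/(pval_s N x).
apply: (_ : _ -> kpreim (path_map (khom_of lu g)) (kimage (rhoM M) T) (pval_s N x)).
apply=> _ [n ->]; exists (jv M (g n)); split.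
  by apply: generated_sub; exists (g n).
rewrite (rho_jval (@jv_inj M) (@jv_surj M) (@jv_unit M)).
exact: (esym (path_map_iota (khom_of lu g) n)).
Qed.

Definition s_lift_fun (x : s_obj N) : M := projT1 (cid (s_lift_ex x)).

(** Uniqueness comes from [j_gen_rho_inj]; it reduces linearity and the value on generators to
    checking these two conditions. *)
Lemma s_lift_eq x m : T m -> rhoM M m = path_map (khom_of lu g) (pval_s N x) ->
  s_lift_fun x = m.
Proof.
move=> Tm em; rewrite /s_lift_fun; case: cid => m' [Tm' em'] /=.
apply: (@j_gen_rho_inj (k_of M) (umod_has_unit lu (M := M)) _ _ (@jv_inj M)
  (@jv_surj M) (@jv_unit M) m' m Tm' Tm).
by rewrite em'.
Qed.

Lemma s_liftP x : T (s_lift_fun x) /\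
  rhoM M (s_lift_fun x) = path_map (khom_of lu g) (pval_s N x).
Proof. by rewrite /s_lift_fun; case: cid. Qed.

Lemma s_liftD x y : s_lift_fun (x + y) = s_lift_fun x + s_lift_fun y.
Proof.
have [[Tx ex] [Ty ey]] := (s_liftP x, s_liftP y).
apply: s_lift_eq; first exact: (smemD Tx Ty).
rewrite [LHS](khomD (rhoM M)) ex ey -[LHS](khomD (path_map _)).
by rewrite -[in LHS](khomD (pval_s N)).
Qed.

Lemma s_liftZ a x : s_lift_fun (act a x) = act a (s_lift_fun x).
Proof.
have [Tx ex] := s_liftP x; apply: s_lift_eq; first exact: (smemA a Tx).
by rewrite [LHS](khomA (rhoM M)) ex -[LHS](khomA (path_map _)).
Qed.

Definition s_lift : umod_hom (s_obj N) M := UModHom s_liftD s_liftZ.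

Lemma s_lift_iota n : s_lift (jv _ (iota_s N n)) = jv M (g n).
Proof.
apply: s_lift_eq; first by apply: generated_sub; exists (g n).
rewrite (rho_jval (@jv_inj M) (@jv_surj M) (@jv_unit M)).
exact: (esym (path_map_iota (khom_of lu g) n)).
Qed.

End SLift.

Lemma adj_sj : left_adjoint functor_s functor_j.
Proof.
exists (fun N (M : umodule LE) (h : umod_hom (s_obj N) M) =>
  umod_comp (fmap functor_j h) (iota_s N)); split=> [N M|N N' M M' a b f].
  apply: inj_surj_bij => [h h' hh|g].
    apply: s_ext => n.
    exact: (congr1 (fun k : umod_hom N (jM M) => jv M (k n)) hh).
  exists (s_lift g); apply: umod_hom_eq => n; apply: jv_inj.
  exact: s_lift_iota.
apply: umod_hom_eq => n; apply: jv_inj.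
exact: (congr1 (fun x => b (f x)) (s_map_iota a n)).
Qed.

Lemma ev_s_fmap N N' (f : umod_hom N N') x :
  ev_s N' (fmap functor_j (fmap functor_s f) x) = f (ev_s N x).
Proof. exact: (ev_path_map (khom_of lu f) (pval_s N (jv _ x))). Qed.

Lemma functor_s_ff : fully_faithful functor_s.
Proof.
move=> N N'; apply: inj_surj_bij => [f g fg|h].
  apply: umod_hom_eq => n.
  have := ev_s_fmap f (iota_s N n); have := ev_s_fmap g (iota_s N n).
  by rewrite iotaSK fg => -> ->.
exists (umod_comp (ev_s N') (umod_comp (fmap functor_j h) (iota_s N))).
apply: s_ext => n; rewrite [LHS]s_map_iota.
exact: (congr1 (jv _) (evSK (@s_sub_iota N') (fmap functor_j h (iota_s N n)))).
Qed.

End Induction.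

(** Every [w m] with [w] in the image lies in j(M); conversely, the vertices of [G] detect the
    elements of j(M), which is unital. *)
Lemma ker_functor_j (M : umodule LE) : ker_functor functor_j M <->
  forall w (m : M), nact (lv (vmap i w)) m = 0.
Proof.
split=> [[Z [Z0 [f [g [gf fg]]]]] w m|M0].
  have um : has_unit (nact (lv (vmap i w)) m : res (k_of M)).
    by exists (lv w); rewrite [LHS]restrictE [LHS]act_vv.
  have [x <-] := jv_surj um.
  have <- : g (f x) = x by exact: (congr1 (fun h : umod_hom (jM M) (jM M) =>
    h x) gf).
  by rewrite (zero_object_eq0 Z0 (f x)) umod_hom0 khom0.
exists (functor_j M); split; last first.
  by exists (idm _), (idm _); rewrite comp1m.
apply: zero_objectP => x; apply: (@vertices_faithful _ (k_of (jM M))) => [|w].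
  exact: (umod_has_unit lu (x : jM M)).
apply: jv_inj; rewrite [LHS]khomA [LHS]restrictE [LHS]M0.
by rewrite khom0.
Qed.

End RestrictionSide.

(** * The recollement *)

Definition restrict_embedding (E : graph) (H : set (vertex E)) (herH :
  hereditary H) :
  embedding (restrict_graph herH) E :=
  @Embedding (restrict_graph herH) E val val val_inj val_inj
    (fun _ => erefl) (fun _ => erefl).

Definition quotient_embedding (E : graph) (X : set (vertex E)) (herX : hereditary X)
    (satX : saturated X) : embedding (quotient_graph herX satX) E :=
  @Embedding (quotient_graph herX satX) E val val val_inj val_inj
    (fun _ => erefl) (fun _ => erefl).

Lemma restrict_out (E : graph) (H : set (vertex E)) (herH : hereditary H) e w :
  src e = vmap (restrict_embedding herH) w ->
  exists e', emap (restrict_embedding herH) e' = e.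
Proof.
move=> ew; have He : H (src e) by rewrite ew; exact: set_mem (valP w).
by exists (SigSub (mem_set (He : [set e | H (src e)] e))).
Qed.

Section Quotient.
Variables (E : graph) (X : set (vertex E)) (herX : hereditary X) (satX :
  saturated X).
Local Notation i := (quotient_embedding herX satX).

Lemma quotient_in v : ~ X v -> exists w, vmap i w = v.
Proof. by move=> Xv; exists (SigSub (mem_set (Xv : (~` X) v))). Qed.

Lemma quotient_notin v : X v -> forall w, vmap i w <> v.
Proof. by move=> Xv w wv; apply: (set_mem (valP w));
  rewrite -[X _]/(X (vmap i w)) wv. Qed.

Lemma quotient_edge_in e w : tgt e = vmap i w -> exists e', emap i e' = e.
Proof.
move=> ew; have Xe : ~ X (tgt e) by move=> /quotient_notin /(_ w) /(_ (esym ew)).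
by exists (SigSub (mem_set (Xe : quotient_edges X e))).
Qed.

(** Saturation enters here: if [w] emitted edges in [E] and all of them ended in [X], then [w] would
    belong to [X]. *)
Lemma quotient_sink w : sink w -> sink (vmap i w).
Proof.
move=> sw; apply: contrapT => /eqP /set0P ne.
have [] := @quotient_notin (vmap i w) _ w erefl.
apply: satX => // _ [e ev <-]; apply: contrapT => Xe.
have [e' ee] := @quotient_edge_in e _ (esym (projT2 (cid (quotient_in Xe)))).
suff : out_edges w e' by rewrite sw.
by apply: (@vmap_inj _ _ i); rewrite -src_emap ee.
Qed.

End Quotient.

(** The vertices killing [M] form a hereditary saturated set: [r(e) = e^* s(e) e], and by (CK2) a
    vertex emitting edges is the sum of the products [e r(e) e^*] over them. *)
Lemma null_hs_closure (K : fieldType) (E : graph) (hE : row_finite E)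
    (H : set (vertex E)) (M : umodule (leavitt K E)) :
  (forall v, H v -> forall m : M, nact (lv v) m = 0) ->
  forall v, hs_closure H v -> forall m : M, nact (lv v) m = 0.
Proof.
move=> H0 v Xv; apply: (Xv [set v | forall m : M, nact (lv v) m = 0]).
split=> //; split=> [e e0 m|w ne w0 m].
  by rewrite -act_ee -act_se e0 nact0r.
rewrite act_ck2 => [|//|sw]; last by move/set0P/eqP: ne.
rewrite big_seq big1 // => e; rewrite in_fset_set // => /set_mem ew.
by rewrite -[nact (lg e) m]act_re w0 ?nact0r //; exists e.
Qed.

Theorem theorem1 (K : fieldType) (E : graph) (hE : row_finite E)
    (H : set (vertex E)) (finH : finite_set H) (herH : hereditary H) :
  inhabited (recollement
    (Mod (leavitt K (quotient_graph (@hs_closure_hereditary E H)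
                                    (@hs_closure_saturated E H))))
    (Mod (leavitt K E))
    (Mod (leavitt K (restrict_graph herH)))).
Proof.
set X := hs_closure H; set herX := @hs_closure_hereditary E H.
set satX := @hs_closure_saturated E H.
have edgeQ := @quotient_edge_in E X herX satX.
have sinkQ := @quotient_sink E X herX satX.
have outH := @restrict_out E H herH.
(* The vertices of E_H are the elements of [H]; this is where its finiteness is used. *)
have finG : finite_set [set: vertex (restrict_graph herH)].
  have -> : [set: vertex (restrict_graph herH)] = val @^-1` H.
    by apply/seteqP; split=> // w _; exact: set_mem (valP w).
  by apply: finite_preimage => // x y _ _; exact: val_inj.
constructor; refine (@Recollement _ _ _
  (functor_i K hE edgeQ sinkQ) (functor_p K hE edgeQ sinkQ) (functor_q K hE
    edgeQ sinkQ)
  (functor_j K hE outH) (functor_r K outH) (functor_s K hE outH)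
  _ _ _ _ _ _ _ _ _ _ _).
- exact: abelian_Mod lu.
- exact: abelian_Mod lu.
- exact: abelian_Mod lu.
- exact: adj_sj.
- exact: adj_jr.
- exact: adj_qi.
- exact: adj_ip.
- exact: functor_i_ff.
- exact: functor_s_ff.
- exact: functor_r_ff.
(* Im i = Ker j now says that the closure of [H] kills [M] exactly if [H] does. *)
move=> M; rewrite ess_image_null ker_functor_j; split=> M0.
  move=> w m; apply: M0; apply: quotient_notin => Y [_]; apply.
  exact: set_mem (valP w).
have H0 v : H v -> forall m : M, nact (lv v) m = 0.
  by move=> Hv m; exact: (M0 (SigSub (mem_set Hv)) m).
move=> v nv m; apply: (null_hs_closure hE H0).
by apply: contrapT => /(quotient_in herX satX) [w /nv].
Qed.
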